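(* Let $a>0$ and $b>0$, and for $x>0$ put $z=x/b$. Let $f_h,f_h',f_h'',f_h'''$ be the solution of the Gamma--Stein equation for $\mathcal G_{a,b}$ and the pointwise representatives of its derivatives defined in the context. If $h\in\mathcal Z_1$, then, for every $x>0$, $$|f_h(x)|\le1,\qquad |f_h'(x)|\le\frac1b C_{a,1}^1(z),\qquad |xf_h'(x)|\le zC_{a,1}^1(z),\qquad |xf_h''(x)|\le\frac2b.$$ If $h\in\mathcal Z_2$, then, for every $x>0$, $$|f_h''(x)|\le\frac1bC_{a,1}^2(z),\qquad |xf_h'''(x)|\le\frac2b.$$
   Context: $\mathcal G_{a,b}$ denotes the Gamma distribution with shape $a>0$ and scale $b>0$, with density $p_{a,b}(x)=\frac{1}{\Gamma(a)b^a}x^{a-1}e^{-x/b}\mathbf 1_{\{x>0\}}$. $\mathcal Z_1$ is the class of continuously differentiable $h:(0,\infty)\to\mathbb R$ with $\|h'\|_\infty\le1$; $\mathcal Z_2$ is the class of twice continuously differentiable $h:(0,\infty)\to\mathbb R$ with $\|h''\|_\infty\le1$. For $x,y>0$ put $P_{a,b}(x)=\int_0^xp_{a,b}(u)\,du$, $\overline P_{a,b}(x)=\int_x^\infty p_{a,b}(u)\,du$, $\underline{\mathrm P}^1_{a,b}(x)=\int_0^xP_{a,b}(u)\,du$, $\overline{\mathrm P}^1_{a,b}(x)=\int_x^\infty\overline P_{a,b}(u)\,du$, $\underline M_{a,b}(y)=\frac{P_{a,b}(y)}{by\,p_{a,b}(y)}$, $\overline M_{a,b}(y)=\frac{\overline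 P_{a,b}(y)}{by\,p_{a,b}(y)}$ (smooth on $(0,\infty)$). Set $$C_{a,b}^1(y)=-\overline M_{a,b}'(y)\underline{\mathrm P}^1_{a,b}(y)+\underline M_{a,b}'(y)\overline{\mathrm P}^1_{a,b}(y),$$ $$C_{a,b}^2(y)=\overline M_{a,b}''(y)\int_0^y\underline{\mathrm P}^1_{a,b}(x)\,dx+\underline M_{a,b}''(y)\int_y^\infty\overline{\mathrm P}^1_{a,b}(x)\,dx.$$ Kernels: for $k\in\{0,1,2\}$, with $M^{(k)}$ the $k$-th derivative, $$K_{a,b}^{k,1}(x,y)=-\overline M_{a,b}^{(k)}(y)\frac{P_{a,b}(x)}{p_{a,b}(x)}\mathbf 1_{\{x\le y\}}-\underline M_{a,b}^{(k)}(y)\frac{\overline P_{a,b}(x)}{p_{a,b}(x)}\mathbf 1_{\{x>y\}},$$ and $$K_{a,b}^{3,2}(x,y)=\overline M_{a,b}'''(y)\frac{\underline{\mathrm P}^1_{a,b}(x)}{p_{a,b}(x)}\mathbf 1_{\{x\le y\}}-\underline M_{a,b}'''(y)\frac{\overline{\mathrm P}^1_{a,b}(x)}{p_{a,b}(x)}\mathbf 1_{\{x>y\}}.$$ With $X\sim\mathcal G_{a,b}$ and $x>0$ define $f_h(x)=\mathbb E[h'(X)K_{a,b}^{0,1}(X,x)]$, $f_h'(x)=\mathbb E[h'(X)K_{a,b}^{1,1}(X,x)]$, $f_h''(x)=\mathbb E[h'(X)K_{a,b}^{2,1}(X,x)]+\frac{h'(x)}{bx}$, $f_h'''(x)=\mathbb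 E[h''(X)K_{a,b}^{3,2}(X,x)]+\frac{h''(x)}{bx}$ (the last for $h\in\mathcal Z_2$). These are the solution $f_h$ of $bxf'(x)-(x-ab)f(x)=h(x)-\int_0^\infty h(u)p_{a,b}(u)\,du$, $x>0$, and its successive derivatives on $(0,\infty)$. *)

(* Defs.v *)
From HB Require Import structures.
From mathcomp Require Import all_boot all_order all_algebra.
From mathcomp Require Import all_classical all_reals all_analysis.

Set Implicit Arguments.
Unset Strict Implicit.
Unset Printing Implicit Defensive.

Import Order.TTheory GRing.Theory Num.Theory.
Import numFieldNormedType.Exports.

Local Open Scope ring_scope.
Local Open Scope classical_set_scope.

Section gamma_law.
Context {R : realType}.
Implicit Types a b x : R.

Local Notation mu := (@lebesgue_measure R).

Definition gamma_fun a : R :=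
  \int[mu]_(u in `]0, +oo[) (u `^ (a - 1) * expR (- u)).

Definition gamma_pdf a b x : R :=
  if 0 < x then (gamma_fun a * b `^ a)^-1 * x `^ (a - 1) * expR (- (x / b))
  else 0.

Definition gamma_prob a b (A : set R) : \bar R :=
  (\int[mu]_(u in A) (gamma_pdf a b u)%:E)%E.

(* Equality is asked on measurable sets only: on the other sets neither side
   has a meaning as a measure. *)
Definition gamma_distributed (d : measure_display) (T : measurableType d)
    (P : probability T R) (X : {RV P >-> R}) a b : Prop :=
  forall A : set R, measurable A -> distribution P X A = gamma_prob a b A.

End gamma_law.

Section test_functions.
Context {R : realType}.

(* A function on (0, +oo) is represented by any function on the whole line
   that extends it: only values and derivatives at positive points matter. *)
Definition classZ1 (h : R -> R) : Prop :=
  forall x : R, 0 < x ->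
    [/\ derivable h x 1, {for x, continuous (derive1 h)} & `|derive1 h x| <= 1].

Definition classZ2 (h : R -> R) : Prop :=
  forall x : R, 0 < x ->
    [/\ derivable h x 1, derivable (derive1 h) x 1,
        {for x, continuous (derive1n 2 h)} & `|derive1n 2 h x| <= 1].

End test_functions.

Section kernels.
Context {R : realType}.
Variables a b : R.

Local Notation mu := (@lebesgue_measure R).

Definition lowP (x : R) : R := \int[mu]_(u in `[0, x]) gamma_pdf a b u.
Definition upP (x : R) : R := \int[mu]_(u in `[x, +oo[) gamma_pdf a b u.

Definition lowP1 (x : R) : R := \int[mu]_(u in `[0, x]) lowP u.
Definition upP1 (x : R) : R := \int[mu]_(u in `[x, +oo[) upP u.

Definition lowM (y : R) : R := lowP y / (b * y * gamma_pdf a b y).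
Definition upM (y : R) : R := upP y / (b * y * gamma_pdf a b y).

Definition C1 (y : R) : R :=
  - derive1 upM y * lowP1 y + derive1 lowM y * upP1 y.

Definition C2 (y : R) : R :=
  derive1n 2 upM y * (\int[mu]_(x in `[0, y]) lowP1 x)
  + derive1n 2 lowM y * (\int[mu]_(x in `[y, +oo[) upP1 x).

(* As [0^-1 = 0], both kernels vanish for [x <= 0 < y], so that the values of
   a test function outside (0, +oo) do not enter the expectations below. *)
Definition K1 (k : nat) (x y : R) : R :=
  - derive1n k upM y * (lowP x / gamma_pdf a b x) * (x <= y)%R%:R
  - derive1n k lowM y * (upP x / gamma_pdf a b x) * (y < x)%R%:R.

Definition K32 (x y : R) : R :=
  derive1n 3 upM y * (lowP1 x / gamma_pdf a b x) * (x <= y)%R%:R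
  - derive1n 3 lowM y * (upP1 x / gamma_pdf a b x) * (y < x)%R%:R.

End kernels.

(* The solution and its derivatives are given by their pointwise integral
   representations.  Expectations are extended-real valued, so a finite bound
   on the absolute value includes the finiteness of the expectation. *)
Section stein_solution.
Context {R : realType} {d : measure_display} {T : measurableType d}.
Variables (P : probability T R) (X : {RV P >-> R}) (a b : R) (h : R -> R).
Local Open Scope ereal_scope.

Definition stein_sol (x : R) : \bar R :=
  'E_P[fun w => (derive1 h (X w) * K1 a b 0 (X w) x)%R].

Definition stein_sol1 (x : R) : \bar R :=
  'E_P[fun w => (derive1 h (X w) * K1 a b 1 (X w) x)%R].

Definition stein_sol2 (x : R) : \bar R :=
  'E_P[fun w => (derive1 h (X w) * K1 a b 2 (X w) x)%R]
  + (derive1 h x / (b * x))%:E.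

Definition stein_sol3 (x : R) : \bar R :=
  'E_P[fun w => (derive1n 2 h (X w) * K32 a b (X w) x)%R]
  + (derive1n 2 h x / (b * x))%:E.

End stein_solution.

(* Main.v *)
Require Import Defs.
From HB Require Import structures.
From mathcomp Require Import all_boot all_order all_algebra.
From mathcomp Require Import all_classical all_reals all_analysis.
From mathcomp Require Import measurable_realfun ring lra.

(* Write P, Q for the lower and upper distribution functions of the density p,
   and L = P/q, U = Q/q with q(y) = b y p(y).  Since q' = (ab - y) p, the
   iterated primitives P1, P2, P3 of P (from 0) and Q1, Q2, Q3 of Q (to
   infinity) are combinations of q and P, resp. Q, with polynomial
   coefficients, and L^(k) = k! P_k / ((b y)^k q),
   U^(k) = (-1)^k k! Q_k / ((b y)^k q).  As P + Q = 1, this gives the exact sums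
     U P1 + L Q1 = 1,  U'' P1 + L'' Q1 = - U''' P2 + L''' Q2 = 1 / (b y),
   and the bounds on f, f', f'' (h in Z_1) and f''' result from integrating the
   absolute value of the kernels.  The second sum also says that K^{2,1}(X, x)
   has mean - 1 / (b x), so that f''(x) = E[(h'(X) - h'(x)) K^{2,1}(X, x)]; for
   h in Z_2 the increment is at most |X - x|, which yields U'' P2 + L'' Q2. *)

Set Implicit Arguments.
Unset Strict Implicit.
Unset Printing Implicit Defensive.

Import Order.TTheory GRing.Theory Num.Theory.
Import numFieldNormedType.Exports.

Local Open Scope ring_scope.
Local Open Scope classical_set_scope.

(** * Derivatives of quotients and of functions known only at positive points *)

Section derivation.
Context {R : realType}.
Implicit Types (f g : R -> R) (x : R).

Lemma is_derive_div f g x df dg d : g x != 0 ->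
  is_derive x 1 f df -> is_derive x 1 g dg ->
  (df * g x - f x * dg) / g x ^+ 2 = d ->
  is_derive x 1 (fun y => f y / g y) d.
Proof.
move=> gx0 Df Dg <-; have Dgv := @is_deriveV _ _ _ _ _ gx0 Dg.
apply: (is_derive_eq (is_deriveM _ _)).
by rewrite /GRing.scale/=; field.
Qed.

(** The half-line is open, so a derivative at a positive point does not see the rest of the line.
    This allows closed forms valid only for positive arguments to be differentiated again. *)
Lemma eq_derive1_gt0 f g : (forall x, 0 < x -> f x = g x) ->
  forall x, 0 < x -> derive1 f x = derive1 g x.
Proof.
move=> fg x x0; rewrite !derive1E; apply: near_eq_derive => //.
near=> y; apply: fg; near: y; exact: lt_nbhsr.
Unshelve. all: by end_near. Qed.

Lemma is_derive1E f x df : is_derive x 1 f df -> derive1 f x = df.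
Proof. by move=> Df; rewrite derive1E (@derive_val _ _ _ _ _ _ _ Df). Qed.

End derivation.

(** * Closed forms of iterated primitives, and derivatives of the ratio [G / q], for both tails at
    once *)

Section primitives.
Context {R : realType}.
Variables (a b s : R) (p G : R -> R).

(* For [s = 1] and [G = lowP], [prim1], [prim2], [prim3] are the iterated
   integrals of [G] from 0 to [x]; for [s = -1] and [G = upP] they are those
   from [x] to infinity. *)
Definition prim1 (x : R) : R := b * x * p x + s * (x - a * b) * G x.
Definition prim2 (x : R) : R :=
  (b * x * G x + s * (x - a * b - b) * prim1 x) / 2.
Definition prim3 (x : R) : R :=
  (b * x * prim1 x + s * (x - a * b - b *+ 2) * prim2 x) / 3.

Hypothesis b0 : 0 < b.
Hypothesis s2 : s ^+ 2 = 1.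
Hypothesis p0 : forall x : R, 0 < x -> 0 < p x.
Hypothesis Dp : forall x : R, 0 < x ->
  is_derive x 1 p (((a - 1) / x - b^-1) * p x).
Hypothesis DG : forall x : R, 0 < x -> is_derive x 1 G (s * p x).

Let bN0 : b != 0. Proof. by rewrite gt_eqF. Qed.

Lemma is_derive_bxp (x : R) : 0 < x ->
  is_derive x 1 (fun y => b * y * p y) ((a * b - x) * p x).
Proof.
move=> x0; have := Dp x0 => Dpx; apply: is_derive_eq.
by rewrite /GRing.scale/=; field; rewrite ?bN0 ?gt_eqF.
Qed.

Lemma is_derive_prim1 (x : R) : 0 < x -> is_derive x 1 prim1 (s * G x).
Proof.
move=> x0; have Dq := is_derive_bxp x0; have DGx := DG x0.
by apply: is_derive_eq; rewrite /GRing.scale/=; ring: s2.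
Qed.

(** Differentiating the affine factor gives one copy of [s * prim1]; as [s ^+ 2 = 1], the remaining
    terms regroup into a second copy, which explains the division by 2. In the next lemma three
    copies of [s * prim2] appear in the same way. *)
Lemma is_derive_prim2 (x : R) : 0 < x -> is_derive x 1 prim2 (s * prim1 x).
Proof.
move=> x0; have DG1 := is_derive_prim1 x0; have DGx := DG x0.
by apply: is_derive_eq; rewrite /GRing.scale/= /prim1; field: s2.
Qed.

Lemma is_derive_prim3 (x : R) : 0 < x -> is_derive x 1 prim3 (s * prim2 x).
Proof.
move=> x0; have DG1 := is_derive_prim1 x0; have DG2 := is_derive_prim2 x0.
by apply: is_derive_eq; rewrite /GRing.scale/= /prim2 /prim1; field: s2.
Qed.

Definition mratio (x : R) : R := G x / (b * x * p x).

Let bxX_neq0 k (x : R) : 0 < x -> (b * x) ^+ k * (b * x * p x) != 0.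
Proof.
by move=> x0; rewrite mulf_neq0 ?expf_neq0 ?mulf_neq0// gt_eqF ?p0.
Qed.

Let is_derive_bxX k (x : R) : 0 < x ->
  is_derive x 1 (fun y => (b * y) ^+ k * (b * y * p y))
    ((b * x) ^+ k * (k%:R * b * p x + (a * b - x) * p x)).
Proof.
move=> x0; have Dq := is_derive_bxp x0.
have Db : is_derive x 1 (fun y => b * y) b.
  by apply: is_derive_eq; rewrite /GRing.scale/= mulr1.
have -> : (fun y => (b * y) ^+ k * (b * y * p y)) =
    (fun y => b * y) ^+ k * (fun y => b * y * p y).
  by apply/funext => y; rewrite fctE exprfctE.
apply: is_derive_eq; rewrite /GRing.scale/= exprfctE.
(* The power rule lowers the exponent; the case split isolates exponent 0. *)
by case: k => [|k] /=; rewrite ?exprS; ring.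
Qed.

(** With q = b x p, the logarithmic derivative of (b x)^k q is (a b + k b - x) / (b x). Hence
    differentiating the k-th primitive divided by (b x)^k q puts into the numerator the recurrence
    that defines the next primitive. Here k = 0; [is_derive_mratio1] and [is_derive_mratio2] are the
    cases k = 1 and k = 2. *)
Lemma is_derive_mratio (x : R) : 0 < x ->
  is_derive x 1 mratio (s * prim1 x / ((b * x) * (b * x * p x))).
Proof.
move=> x0; have [xN0 pN0] : x != 0 /\ p x != 0 by rewrite !gt_eqF// p0.
apply: (is_derive_div _ (DG x0) (is_derive_bxp x0)).
  by rewrite !mulf_neq0.
by rewrite /prim1; field: s2; rewrite pN0 xN0 bN0.
Qed.

Lemma is_derive_mratio1 (x : R) : 0 < x ->
  is_derive x 1 (fun y => s * prim1 y / ((b * y) * (b * y * p y)))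
  (2 * prim2 x / ((b * x) ^+ 2 * (b * x * p x))).
Proof.
move=> x0; have [xN0 pN0] : x != 0 /\ p x != 0 by rewrite !gt_eqF// p0.
have DN : is_derive x 1 (fun y => s * prim1 y) (s * (s * G x)).
  by have ? := is_derive_prim1 x0; apply: is_derive_eq.
(* The exponent 1 is spelled out to fit the general power lemma; it disappears by computation. *)
apply: (is_derive_div (g := fun y => (b * y) ^+ 1 * (b * y * p y))
  (bxX_neq0 1 x0) DN (is_derive_bxX 1 x0)).
rewrite /prim2 /prim1.
by field: s2; rewrite pN0 xN0 bN0.
Qed.

Lemma is_derive_mratio2 (x : R) : 0 < x ->
  is_derive x 1 (fun y => 2 * prim2 y / ((b * y) ^+ 2 * (b * y * p y)))
  (6 * s * prim3 x / ((b * x) ^+ 3 * (b * x * p x))).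
Proof.
move=> x0; have [xN0 pN0] : x != 0 /\ p x != 0 by rewrite !gt_eqF// p0.
have DN : is_derive x 1 (fun y => 2 * prim2 y) (2 * (s * prim1 x)).
  by have ? := is_derive_prim2 x0; apply: is_derive_eq.
apply: (is_derive_div (g := fun y => (b * y) ^+ 2 * (b * y * p y))
  (bxX_neq0 2 x0) DN (is_derive_bxX 2 x0)).
rewrite /prim3 /prim2 /prim1.
by field: s2; rewrite pN0 xN0 bN0.
Qed.

Lemma derive1_mratio (x : R) : 0 < x ->
  derive1 mratio x = s * prim1 x / ((b * x) * (b * x * p x)).
Proof. by move=> x0; exact/is_derive1E/is_derive_mratio. Qed.

Lemma derive2_mratio (x : R) : 0 < x ->
  derive1n 2 mratio x = 2 * prim2 x / ((b * x) ^+ 2 * (b * x * p x)).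
Proof.
move=> x0; rewrite !derive1nS derive1n0 (eq_derive1_gt0 derive1_mratio x0).
exact/is_derive1E/is_derive_mratio1.
Qed.

Lemma derive3_mratio (x : R) : 0 < x ->
  derive1n 3 mratio x = 6 * s * prim3 x / ((b * x) ^+ 3 * (b * x * p x)).
Proof.
move=> x0; rewrite derive1nS (eq_derive1_gt0 derive2_mratio x0).
exact/is_derive1E/is_derive_mratio2.
Qed.

End primitives.

(** * Fundamental theorem of calculus from 0 and up to infinity *)

Section half_line_ftc.
Context {R : realType}.
Implicit Types (f F : R -> R) (x : R).
Local Notation mu := (@lebesgue_measure R).

Lemma is_derive_continuous f x df : is_derive x 1 f df -> {for x, continuous f}.
Proof. by case=> fx _; exact/differentiable_continuous/derivable1_diffP. Qed.

(** Lets a limit produced by the algebra of limits, such as [c * 0], be replaced by its simplified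
    value. *)
Lemma cvgr_eq {T : Type} {F : set_system T} (f : T -> R) (l l' : R) :
  f @ F --> l -> l = l' -> f @ F --> l'.
Proof. by move=> + <-. Qed.

(** At 0 only continuity from the right is available: the values of [f] and [F] there have to agree
    with their right limits. *)
Lemma integral_FTC_from0 f F x : 0 < x ->
  (forall y : R, 0 < y -> {for y, continuous f}) ->
  (forall y : R, 0 < y -> is_derive y 1 F (f y)) ->
  f y @[y --> 0^'+] --> f 0 -> F y @[y --> 0^'+] --> 0 -> F 0 = 0 ->
  (\int[mu]_(y in `[0%R, x]) (f y)%:E = (F x)%:E)%E.
Proof.
move=> x0 cf DF f0 F0 F00.
rewrite (@continuous_FTC2 _ f F)// ?F00 ?sube0//.
- apply/continuous_within_itvP => //; split => //.
    by move=> y; rewrite in_itv/= => /andP[y0 _]; exact: cf.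
  exact/cvg_at_left_filter/cf.
- split; last 2 first.
    by rewrite F00.
    by apply/cvg_at_left_filter/(is_derive_continuous (DF x x0)).
  by move=> y; rewrite in_itv/= => /andP[y0 _]; case: (DF y y0).
- by move=> y; rewrite in_itv/= => /andP[y0 _]; exact/is_derive1E/DF.
Qed.

(** Integrability need not be shown beforehand: [f] is nonnegative, and the finite limit [l] of the
    primitive makes the integral finite. *)
Lemma integral_FTC_toy f F x (l : R) : 0 < x ->
  (forall y : R, 0 < y -> {for y, continuous f}) ->
  (forall y : R, 0 < y -> is_derive y 1 F (f y)) ->
  (forall y, x <= y -> 0 <= f y) -> F y @[y --> +oo] --> l ->
  (\int[mu]_(y in `[x, +oo[) (f y)%:E = (l - F x)%:E)%E.
Proof.
move=> x0 cf DF f0 Fl.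
rewrite (@ge0_continuous_FTC2y _ f F x l)//.
- apply/continuous_within_itvcyP; split.
    move=> y; rewrite in_itv/= andbT => xy; exact/cf/(lt_trans x0).
  exact/cvg_at_right_filter/cf.
- by move=> y xy; case: (DF y (lt_trans x0 xy)).
- exact/cvg_at_right_filter/(is_derive_continuous (DF x x0)).
- move=> y; rewrite in_itv/= andbT => xy.
  exact/is_derive1E/DF/(lt_trans x0).
Qed.

Lemma cvg_at0rM0 (c f : R -> R) : continuous c -> f y @[y --> 0^'+] --> 0 ->
  c y * f y @[y --> 0^'+] --> 0.
Proof.
move=> cc f0; apply: cvgr_eq (mulr0 (c 0)); apply: cvgM => //.
exact/cvg_at_right_filter/cc.
Qed.

Lemma cvg_at0rD0 (f g : R -> R) : f y @[y --> 0^'+] --> 0 ->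
  g y @[y --> 0^'+] --> 0 -> f y + g y @[y --> 0^'+] --> 0.
Proof. by move=> f0 g0; apply: cvgr_eq (addr0 0); exact: cvgD. Qed.

Lemma affine_continuous (c d : R) : continuous (fun y : R => c * y + d).
Proof.
move=> y; apply: cvgD; last exact: cvg_cst.
by apply: cvgM; [exact: cvg_cst|exact: cvg_id].
Qed.

Lemma cvgyZ0 (c : R) (f : R -> R) : f y @[y --> +oo] --> 0 ->
  c * f y @[y --> +oo] --> 0.
Proof.
by move=> f0; apply: cvgr_eq (mulr0 c); apply: cvgM => //; exact: cvg_cst.
Qed.

Lemma cvgyD0 (f g : R -> R) : f y @[y --> +oo] --> 0 ->
  g y @[y --> +oo] --> 0 -> f y + g y @[y --> +oo] --> 0.
Proof. by move=> f0 g0; apply: cvgr_eq (addr0 0); exact: cvgD. Qed.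

Lemma integral_FTC_toy0 (f F : R -> R) (x : R) : 0 < x ->
  (forall y : R, 0 < y -> {for y, continuous f}) ->
  (forall y : R, 0 < y -> is_derive y 1 F (- f y)) ->
  (forall y, x <= y -> 0 <= f y) -> F y @[y --> +oo] --> 0 ->
  (\int[mu]_(y in `[x, +oo[) (f y)%:E = (F x)%:E)%E.
Proof.
move=> x0 cf DF f0 Fy.
have DNF (y : R) : 0 < y -> is_derive y 1 (fun z => - F z) (f y).
  by move=> y0; have DFy := DF y y0; rewrite -[f y]opprK; exact: is_deriveN.
have NFy : - F y @[y --> +oo] --> 0 by apply: cvgr_eq (oppr0 R); exact: cvgN.
by rewrite (integral_FTC_toy x0 cf DNF f0 NFy) sub0r opprK.
Qed.

(** The open half-line carries the continuity; measurability then passes to its measurable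
    subsets. *)
Lemma measurable_gt0_continuous (f : R -> R) (D : set R) : measurable D ->
  D `<=` `]0, +oo[ -> (forall u : R, 0 < u -> {for u, continuous f}) ->
  measurable_fun D f.
Proof.
move=> mD D0 cf; apply: (measurable_funS _ D0) => //.
apply: open_continuous_measurable_fun; first exact: interval_open.
by move=> u; rewrite inE/= in_itv/= andbT; exact: cf.
Qed.

End half_line_ftc.

(** * The Gamma density, its two distribution functions, and their limits at 0 and infinity *)

Section gamma_density.
Context {R : realType}.
Variables a b : R.
Hypotheses (a0 : 0 < a) (b0 : 0 < b).
Local Notation mu := (@lebesgue_measure R).
Local Notation p := (gamma_pdf a b).
Hypothesis mass1 : (\int[mu]_u (p u)%:E = 1)%E.

Lemma gamma_pdf_le0 x : x <= 0 -> p x = 0.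
Proof. by rewrite /gamma_pdf ltNge => ->. Qed.

Lemma gamma_pdfE x : 0 < x ->
  p x = (gamma_fun a * b `^ a)^-1 * x `^ (a - 1) * expR (- (x / b)).
Proof. by rewrite /gamma_pdf => ->. Qed.

Lemma gamma_fun_ge0 : 0 <= gamma_fun a.
Proof. by apply: Rintegral_ge0 => u _; rewrite mulr_ge0 ?powR_ge0 ?expR_ge0. Qed.

Lemma gamma_pdf_ge0 x : 0 <= p x.
Proof.
rewrite /gamma_pdf; case: ifP => // _.
by rewrite !mulr_ge0 ?invr_ge0 ?mulr_ge0 ?gamma_fun_ge0 ?powR_ge0 ?expR_ge0.
Qed.

(** If the Gamma integral were 0, its inverse would be 0 by convention and the density would vanish
    identically, against [mass1]. *)
Lemma gamma_fun_gt0 : 0 < gamma_fun a.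
Proof.
rewrite lt_neqAle gamma_fun_ge0 andbT.
apply/eqP => g0; move: mass1; rewrite integral0_eq.
  by move=> /eqP; rewrite eqe eq_sym oner_eq0.
by move=> u _; rewrite /gamma_pdf -g0 mul0r invr0 !mul0r; case: ifP.
Qed.

Lemma gamma_pdf_gt0 x : 0 < x -> 0 < p x.
Proof.
move=> x0; rewrite gamma_pdfE// !mulr_gt0 ?expR_gt0 ?powR_gt0//.
by rewrite invr_gt0 mulr_gt0 ?gamma_fun_gt0 ?powR_gt0.
Qed.

Lemma is_derive_gamma_pdf (x : R) : 0 < x ->
  is_derive x 1 p (((a - 1) / x - b^-1) * p x).
Proof.
move=> x0; set c := (gamma_fun a * b `^ a)^-1.
pose g y : R := c * y `^ (a - 1) * expR (- (y / b)).
(* Near a positive point the test in [gamma_pdf] is true, so the density may be replaced by the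
   smooth formula [g]. *)
apply: (@near_eq_is_derive _ _ _ g) => //.
  by near=> y; rewrite /g gamma_pdfE//; near: y; exact: lt_nbhsr.
have Dp := is_derive1_powR (a - 1) x0.
have De : is_derive x 1 (fun y => expR (- (y / b))) (expR (- (x / b)) * (- b^-1)).
  apply: (@is_derive1_comp _ expR (fun y => - (y / b))).
  by apply: is_derive_eq; rewrite /GRing.scale/= mulr1 mulr0 add0r.
apply: is_derive_eq; rewrite gamma_pdfE// -/c /GRing.scale/=.
rewrite (_ : x `^ (a - 1 - 1) = x `^ (a - 1) / x); last first.
  by rewrite powRB ?(gt_eqF x0) ?implybT// powRr1// ltW.
by field; rewrite !gt_eqF.
Unshelve. all: by end_near. Qed.

Lemma measurable_gamma_pdf : measurable_fun setT p.
Proof.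
apply: measurable_fun_ifT => //=.
  exact: measurable_fun_ltr.
apply: measurable_funM; first apply: measurable_funM => //.
apply: measurableT_comp => //; apply: measurableT_comp => //.
exact: measurable_funM.
Qed.

Lemma integrable_gamma_pdf : mu.-integrable setT (EFin \o p).
Proof.
apply/integrableP; split; first by apply/measurable_EFinP; exact: measurable_gamma_pdf.
under eq_integral do rewrite /= ger0_norm ?gamma_pdf_ge0//.
by rewrite mass1 ltry.
Qed.

Lemma gamma_pdf_continuous x : 0 < x -> {for x, continuous p}.
Proof. by move=> /is_derive_gamma_pdf/is_derive_continuous. Qed.

Local Notation P := (lowP a b).
Local Notation Q := (upP a b).

Lemma integral_gamma_pdf_ge0 :
  (\int[mu]_(u in `[0%R, +oo[) (p u)%:E = 1)%E.
Proof.
rewrite -[RHS]mass1 integral_mkcond; apply: eq_integral => u _.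
rewrite patchE; case: ifPn => //; rewrite notin_setE/= in_itv/= andbT.
by move/negP; rewrite -ltNge => /ltW/gamma_pdf_le0 ->.
Qed.

Let integrable_p A : measurable A -> mu.-integrable A (EFin \o p).
Proof. by move=> mA; exact: (integrableS measurableT _ _ integrable_gamma_pdf). Qed.

Lemma lowP_upP x : 0 <= x -> P x + Q x = 1.
Proof.
(* The right-hand interval is opened at [x], which makes it the exact complement of [0, x] in [0,
   +oo[. *)
move=> x0; rewrite /upP -Rintegral_itv_obnd_cbnd; last exact: integrable_p.
have := @Rintegral_itvB R p (BLeft 0) +oo%O x (integrable_p (measurable_itv _)).
rewrite !bnd_simp => /(_ x0 isT) <-.
by rewrite addrC subrK /Rintegral integral_gamma_pdf_ge0.
Qed.

Lemma lowP0 : P 0 = 0.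
Proof. by rewrite /lowP set_itv1 Rintegral_set1. Qed.

Lemma lowP_ge0 x : 0 <= P x.
Proof. by apply: Rintegral_ge0 => u _; exact: gamma_pdf_ge0. Qed.

Lemma upP_ge0 x : 0 <= Q x.
Proof. by apply: Rintegral_ge0 => u _; exact: gamma_pdf_ge0. Qed.

Lemma lowP_nondecreasing : {homo P : x y / x <= y}.
Proof.
move=> x y xy; apply: fine_le.
- exact/integrable_fin_num/integrable_p.
- exact/integrable_fin_num/integrable_p.
- apply: ge0_subset_integral => //.
  + by apply/measurable_EFinP/measurable_funTS; exact: measurable_gamma_pdf.
  + by move=> u _; rewrite lee_fin gamma_pdf_ge0.
  + by apply: subset_itvl; rewrite bnd_simp.
Qed.

Lemma lowP_le1 x : P x <= 1.
Proof.
have [x0|x0] := leP 0 x; first by rewrite -(lowP_upP x0) lerDl upP_ge0.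
by rewrite /lowP set_itv_ge ?Rintegral_set0// bnd_simp -ltNge.
Qed.

Lemma is_derive_lowP (x : R) : 0 < x -> is_derive x 1 P (p x).
Proof.
(* The upper end [x + 1] serves only to make [x] an interior point. *)
move=> x0; have ip : mu.-integrable `[0, x + 1] (EFin \o p) by exact: integrable_p.
have [|DP PE] := continuous_FTC1_closed _ ip x0 (gamma_pdf_continuous x0).
  by rewrite ltrDl.
by apply: (DeriveDef DP); rewrite -derive1E; exact: PE.
Qed.

Lemma is_derive_upP (x : R) : 0 < x -> is_derive x 1 Q (- p x).
Proof.
move=> x0; apply: (@near_eq_is_derive _ _ _ (fun y => 1 - P y)).
  near=> y; apply/eqP; rewrite subr_eq addrC eq_sym lowP_upP//.
  by apply/ltW; near: y; exact: lt_nbhsr.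
have DP := is_derive_lowP x0.
by apply: is_derive_eq; rewrite add0r mul1r.
Unshelve. all: by end_near. Qed.

Lemma lowP_cvg0 : P y @[y --> 0^'+] --> 0.
Proof.
have ip : mu.-integrable `[0, 1] (EFin \o p) by exact: integrable_p.
exact/cvg_at_right_filter/(parameterized_integral_cvg_left ltr01 ip).
Qed.

(* Monotonicity gives some limit; integrating the density over [1, +oo[ with
   this limit identifies it as the total mass. *)
Lemma lowP_cvgy : P y @[y --> +oo] --> (1 : R).
Proof.
have ubP : has_ubound (range P) by exists 1 => _ [x _ <-]; exact: lowP_le1.
have Pl := nondecreasing_cvgr lowP_nondecreasing ubP.
set l := sup _ in Pl.
suff <- : l = 1 by [].
have := integral_FTC_toy ltr01 gamma_pdf_continuous is_derive_lowP
  (fun y _ => gamma_pdf_ge0 y) Pl.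
move=> /(congr1 fine)/= => QE; rewrite -(lowP_upP ler01) /upP /Rintegral QE.
by rewrite subrKC.
Qed.

Lemma upP_cvgy : Q y @[y --> +oo] --> 0.
Proof.
apply: (@cvg_trans _ ((1 - P y) @[y --> +oo])).
  apply: near_eq_cvg; near=> y.
  have y0 : 0 <= y by near: y; apply: nbhs_pinfty_ge; rewrite num_real.
  by apply/eqP; rewrite subr_eq addrC lowP_upP.
apply: cvgr_eq (subrr 1); apply: cvgB; first exact: cvg_cst.
exact: lowP_cvgy.
Unshelve. all: by end_near. Qed.

(** The density may blow up at 0 when a < 1; the extra factor y turns y^(a-1) into y^a, which tends
    to 0 as a > 0. *)
Lemma bxp_cvg0 : b * y * p y @[y --> 0^'+] --> 0.
Proof.
set c := (gamma_fun a * b `^ a)^-1.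
apply: (@cvg_trans _ ((b * c * y `^ a * expR (- (y / b))) @[y --> 0^'+])).
  apply: near_eq_cvg; near=> y.
  have y0 : 0 < y by near: y; exact: nbhs_right_gt.
  by rewrite gamma_pdfE// -(mulr_powRB1 (ltW y0) a0) -/c; ring.
apply: cvgr_eq (mul0r (expR (- (0 / b)))); apply: cvgM.
  apply: cvgr_eq (mulr0 (b * c)); apply: cvgM; first exact: cvg_cst.
  exact: powR_cvg0.
apply: cvg_at_right_filter; apply: continuous_comp; last exact: continuous_expR.
by apply: cvgN; apply: cvgM; [exact: cvg_id|exact: cvg_cst].
Unshelve. all: by end_near. Qed.

Lemma cvgy_inv (k : R) : k / y @[y --> +oo] --> 0.
Proof.
apply: cvgr_eq (mulr0 k); apply: cvgM; first exact: cvg_cst.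
apply/(@gtr0_cvgV0 _ _ _ _ id); last exact: cvg_id.
by near=> y; near: y; apply: nbhs_pinfty_gt; rewrite num_real.
Unshelve. all: by end_near. Qed.

(** The exponential dominates every power: for y >= 1 the power part is at most y^m, while the
    exponential series bounds e^(y/b) below by (y/b)^(m+1) / (m+1)!, leaving a quotient k / y. *)
Lemma xXp_cvgy n : y ^+ n * p y @[y --> +oo] --> 0.
Proof.
set c := (gamma_fun a * b `^ a)^-1.
have c0 : 0 < c by rewrite invr_gt0 mulr_gt0 ?gamma_fun_gt0 ?powR_gt0.
(* An integer exponent at least n + a - 1; [k] collects what remains after one term of the
   exponential series has absorbed y^m. *)
pose m := (n + Num.bound a)%N.
pose k := c * b ^+ m.+1 * (m.+1)`!%:R.
apply: (@squeeze_cvgr _ _ _ _ (cst 0) (fun y => k / y)); last 2 first.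
- exact: cvg_cst.
- exact: cvgy_inv.
near=> y; have y1 : 1 <= y by near: y; apply: nbhs_pinfty_ge; rewrite num_real.
have y0 : 0 < y := lt_le_trans ltr01 y1.
rewrite mulr_ge0 ?gamma_pdf_ge0 ?exprn_ge0 ?(ltW y0)//= gamma_pdfE// -/c.
have pow_le : y ^+ n * y `^ (a - 1) <= y ^+ m.
  rewrite exprD ler_wpM2l ?exprn_ge0 ?(ltW y0)// -powR_mulrn ?(ltW y0)//.
  apply: ler_powR => //; rewrite (le_trans (y := a)) ?lerBlDr ?lerDl//.
  by rewrite ltW// archi_boundP// ltW.
have exp_ge : (y / b) ^+ m.+1 / (m.+1)`!%:R <= expR (y / b).
  by apply: le_trans (expR_ge1Dxn m _); rewrite ?lerDr// divr_ge0// ltW.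
have yb0 : 0 < (y / b) ^+ m.+1 / (m.+1)`!%:R.
  by rewrite divr_gt0 ?exprn_gt0 ?divr_gt0// ltr0n fact_gt0.
rewrite expRN.
have -> : k / y = c * (y ^+ m / ((y / b) ^+ m.+1 / (m.+1)`!%:R)).
  rewrite /k expr_div_n !exprS; field.
  by rewrite !expf_neq0 ?gt_eqF// ltr0n fact_gt0.
rewrite [leLHS](_ : _ = c * (y ^+ n * y `^ (a - 1) / expR (y / b))); last by ring.
rewrite ler_pM2l// ler_pM// ?mulr_ge0 ?invr_ge0 ?expR_ge0 ?powR_ge0 ?exprn_ge0 ?(ltW y0)//.
by rewrite lef_pV2// posrE expR_gt0.
Unshelve. all: by end_near. Qed.

(* [upP - b x p] is eventually nondecreasing and vanishes at infinity. *)
Lemma upP_le_bxp x : a * b + 1 <= x -> Q x <= b * x * p x.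
Proof.
move=> abx; have x0 : 0 < x.
  by rewrite (lt_le_trans _ abx)// ltr_pwDr// mulr_ge0 ?ltW.
pose F y : R := Q y - b * y * p y.
have DF (y : R) : 0 < y -> is_derive y 1 F ((y - a * b - 1) * p y).
  move=> y0; have DQ := is_derive_upP y0.
  have Dq := is_derive_bxp b0 is_derive_gamma_pdf y0.
  by apply: is_derive_eq; ring.
have Fy : F y @[y --> +oo] --> 0.
  apply: cvgr_eq (subr0 0); apply: cvgB; first exact: upP_cvgy.
  under eq_cvg do rewrite -mulrA.
  apply: cvgr_eq (mulr0 b); apply: cvgM; first exact: cvg_cst.
  by under eq_cvg do rewrite -[X in X * _]expr1; exact: xXp_cvgy.
rewrite -subr_le0 -/(F x) -oppr_ge0 -sub0r.
rewrite -lee_fin -(integral_FTC_toy x0 _ DF _ Fy).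
- apply: integral_ge0 => y; rewrite /= in_itv/= andbT => xy.
  by rewrite lee_fin mulr_ge0 ?gamma_pdf_ge0//; lra.
- move=> y y0; apply: cvgM; last exact: gamma_pdf_continuous.
  by apply: cvgB; [apply: cvgB; [exact: cvg_id|exact: cvg_cst]|exact: cvg_cst].
- by move=> y xy; rewrite mulr_ge0 ?gamma_pdf_ge0//; lra.
Qed.

(** By [upP_le_bxp] the tail is eventually below b y p(y), at the cost of one more power of y. *)
Lemma xXupP_cvgy n : y ^+ n * Q y @[y --> +oo] --> 0.
Proof.
apply: (@squeeze_cvgr _ _ _ _ (cst 0) (fun y => b * (y ^+ n.+1 * p y))).
- near=> y; have y0 : 0 <= y by near: y; apply: nbhs_pinfty_ge; rewrite num_real.
  have aby : a * b + 1 <= y by near: y; apply: nbhs_pinfty_ge; rewrite num_real.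
  rewrite mulr_ge0 ?upP_ge0 ?exprn_ge0//=.
  rewrite [leRHS](_ : _ = y ^+ n * (b * y * p y)); last by rewrite exprS; ring.
  by rewrite ler_wpM2l ?exprn_ge0 ?upP_le_bxp.
- exact: cvg_cst.
- apply: cvgr_eq (mulr0 b); apply: cvgM; first exact: cvg_cst.
  exact: xXp_cvgy.
Unshelve. all: by end_near. Qed.

End gamma_density.

(** * Iterated primitives of [lowP] and [upP], derivatives of [lowM] and [upM], and the exact
    sums *)

Section gamma_primitives.
Context {R : realType}.
Variables a b : R.
Hypotheses (a0 : 0 < a) (b0 : 0 < b).
Local Notation mu := (@lebesgue_measure R).
Local Notation p := (gamma_pdf a b).
Hypothesis mass1 : (\int[mu]_u (p u)%:E = 1)%E.
Local Notation P := (lowP a b).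
Local Notation Q := (upP a b).
Local Notation L1 := (prim1 a b 1 p P).
Local Notation L2 := (prim2 a b 1 p P).
Local Notation L3 := (prim3 a b 1 p P).
Local Notation U1 := (prim1 a b (-1) p Q).
Local Notation U2 := (prim2 a b (-1) p Q).
Local Notation U3 := (prim3 a b (-1) p Q).
Local Notation q x := (b * x * p x).

Let p0 := gamma_pdf_gt0 b0 mass1.
Let Dp := is_derive_gamma_pdf a b0.

Let DP (x : R) : 0 < x -> is_derive x 1 P (1 * p x).
Proof. by rewrite mul1r; exact: is_derive_lowP. Qed.

Let DQ (x : R) : 0 < x -> is_derive x 1 Q (-1 * p x).
Proof. by rewrite mulN1r; exact: is_derive_upP. Qed.

Let sqr1 : 1 ^+ 2 = 1 :> R. Proof. by rewrite expr1n. Qed.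
Let sqrN1 : (-1) ^+ 2 = 1 :> R. Proof. by rewrite sqrrN expr1n. Qed.

Lemma is_derive_lowprim1 (x : R) : 0 < x -> is_derive x 1 L1 (P x).
Proof. by move=> x0; have := is_derive_prim1 b0 sqr1 Dp DP x0; rewrite mul1r. Qed.

Lemma is_derive_lowprim2 (x : R) : 0 < x -> is_derive x 1 L2 (L1 x).
Proof. by move=> x0; have := is_derive_prim2 b0 sqr1 Dp DP x0; rewrite mul1r. Qed.

Lemma is_derive_lowprim3 (x : R) : 0 < x -> is_derive x 1 L3 (L2 x).
Proof. by move=> x0; have := is_derive_prim3 b0 sqr1 Dp DP x0; rewrite mul1r. Qed.

Lemma is_derive_upprim1 (x : R) : 0 < x -> is_derive x 1 U1 (- Q x).
Proof. by move=> x0; have := is_derive_prim1 b0 sqrN1 Dp DQ x0; rewrite mulN1r. Qed.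

Lemma is_derive_upprim2 (x : R) : 0 < x -> is_derive x 1 U2 (- U1 x).
Proof. by move=> x0; have := is_derive_prim2 b0 sqrN1 Dp DQ x0; rewrite mulN1r. Qed.

Lemma is_derive_upprim3 (x : R) : 0 < x -> is_derive x 1 U3 (- U2 x).
Proof. by move=> x0; have := is_derive_prim3 b0 sqrN1 Dp DQ x0; rewrite mulN1r. Qed.

Lemma lowP_continuous (x : R) : 0 < x -> {for x, continuous P}.
Proof. by move=> /DP/is_derive_continuous. Qed.

Lemma upP_continuous (x : R) : 0 < x -> {for x, continuous Q}.
Proof. by move=> /DQ/is_derive_continuous. Qed.

Lemma lowprim1_continuous (x : R) : 0 < x -> {for x, continuous L1}.
Proof. by move=> /is_derive_lowprim1/is_derive_continuous. Qed.

Lemma upprim1_continuous (x : R) : 0 < x -> {for x, continuous U1}.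
Proof. by move=> /is_derive_upprim1/is_derive_continuous. Qed.

Lemma lowprim2_continuous (x : R) : 0 < x -> {for x, continuous L2}.
Proof. by move=> /is_derive_lowprim2/is_derive_continuous. Qed.

Lemma upprim2_continuous (x : R) : 0 < x -> {for x, continuous U2}.
Proof. by move=> /is_derive_upprim2/is_derive_continuous. Qed.

Lemma lowprim1_cvg0 : L1 y @[y --> 0^'+] --> 0.
Proof.
apply: cvg_at0rD0; first exact: bxp_cvg0.
apply: cvg_at0rM0; last exact: lowP_cvg0.
have -> : (fun y => 1 * (y - a * b)) = (fun y => 1 * y + - (a * b)).
  by apply/funext => y; ring.
exact: affine_continuous.
Qed.

Lemma lowprim2_cvg0 : L2 y @[y --> 0^'+] --> 0.
Proof.
have -> : L2 = (fun y => (b / 2 * y + 0) * P y +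
    (2^-1 * y + - (a * b + b) / 2) * L1 y).
  by apply/funext => y; rewrite /prim2; field.
apply: cvg_at0rD0.
- by apply: cvg_at0rM0; [exact: affine_continuous|exact: lowP_cvg0].
- by apply: cvg_at0rM0; [exact: affine_continuous|exact: lowprim1_cvg0].
Qed.

Lemma lowprim3_cvg0 : L3 y @[y --> 0^'+] --> 0.
Proof.
have -> : L3 = (fun y => (b / 3 * y + 0) * L1 y +
    (3^-1 * y + - (a * b + b *+ 2) / 3) * L2 y).
  by apply/funext => y; rewrite /prim3; field.
apply: cvg_at0rD0.
- by apply: cvg_at0rM0; [exact: affine_continuous|exact: lowprim1_cvg0].
- by apply: cvg_at0rM0; [exact: affine_continuous|exact: lowprim2_cvg0].
Qed.

(** Each step of the recurrence multiplies by y, so the decay is established against every power of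
    y. *)
Lemma xXupprim1_cvgy n : y ^+ n * U1 y @[y --> +oo] --> 0.
Proof.
have -> : (fun y => y ^+ n * U1 y) = (fun y => b * (y ^+ n.+1 * p y) +
    (-1 * (y ^+ n.+1 * Q y) + a * b * (y ^+ n * Q y))).
  by apply/funext => y; rewrite /prim1 exprS; ring.
apply: cvgyD0; first exact/cvgyZ0/xXp_cvgy.
by apply: cvgyD0; exact/cvgyZ0/xXupP_cvgy.
Qed.

Lemma xXupprim2_cvgy n : y ^+ n * U2 y @[y --> +oo] --> 0.
Proof.
have -> : (fun y => y ^+ n * U2 y) = (fun y => b / 2 * (y ^+ n.+1 * Q y) +
    (- 2^-1 * (y ^+ n.+1 * U1 y) + (a * b + b) / 2 * (y ^+ n * U1 y))).
  by apply/funext => y; rewrite /prim2 exprS; field.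
apply: cvgyD0; first exact/cvgyZ0/xXupP_cvgy.
by apply: cvgyD0; exact/cvgyZ0/xXupprim1_cvgy.
Qed.

Lemma upprim3_cvgy : U3 y @[y --> +oo] --> 0.
Proof.
have -> : U3 = (fun y => b / 3 * (y ^+ 1 * U1 y) +
    (- 3^-1 * (y ^+ 1 * U2 y) + (a * b + b *+ 2) / 3 * (y ^+ 0 * U2 y))).
  by apply/funext => y; rewrite /prim3 expr0 expr1; field.
apply: cvgyD0; first exact/cvgyZ0/xXupprim1_cvgy.
by apply: cvgyD0; exact/cvgyZ0/xXupprim2_cvgy.
Qed.

(** Rests on the convention that the density is 0 at 0; [integral_FTC_from0] needs this value. *)
Lemma lowprim1_0 : L1 0 = 0.
Proof. by rewrite /prim1 gamma_pdf_le0// lowP0; ring. Qed.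

Lemma lowprim2_0 : L2 0 = 0.
Proof. by rewrite /prim2 lowprim1_0; ring. Qed.

Lemma lowprim3_0 : L3 0 = 0.
Proof. by rewrite /prim3 lowprim2_0; ring. Qed.

Let upprim1_cvgy : U1 y @[y --> +oo] --> 0.
Proof.
by have := xXupprim1_cvgy 0; under eq_cvg do rewrite expr0 mul1r.
Qed.

Let upprim2_cvgy : U2 y @[y --> +oo] --> 0.
Proof.
by have := xXupprim2_cvgy 0; under eq_cvg do rewrite expr0 mul1r.
Qed.

Lemma integral_lowP x : 0 < x ->
  (\int[mu]_(u in `[0%R, x]) (P u)%:E = (L1 x)%:E)%E.
Proof.
move=> x0; apply: (integral_FTC_from0 x0 lowP_continuous is_derive_lowprim1).
- by rewrite lowP0; exact: lowP_cvg0.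
- exact: lowprim1_cvg0.
- exact: lowprim1_0.
Qed.

Lemma integral_upP x : 0 < x ->
  (\int[mu]_(u in `[x, +oo[) (Q u)%:E = (U1 x)%:E)%E.
Proof.
move=> x0; apply: (integral_FTC_toy0 x0 upP_continuous is_derive_upprim1) => //.
by move=> y _; exact: upP_ge0.
Qed.

Lemma lowP1E x : 0 <= x -> lowP1 a b x = L1 x.
Proof.
rewrite le_eqVlt => /predU1P[<-|x0]; last by rewrite /lowP1 /Rintegral integral_lowP.
by rewrite lowprim1_0 /lowP1 set_itv1 Rintegral_set1.
Qed.

Lemma upP1E x : 0 < x -> upP1 a b x = U1 x.
Proof. by move=> x0; rewrite /upP1 /Rintegral integral_upP. Qed.

(** The sign is not visible on the closed form, whose factor x - a b changes sign; it comes from the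
    integral form. The later primitives inherit it by integration. *)
Lemma lowprim1_ge0 x : 0 <= x -> 0 <= L1 x.
Proof.
by move=> x0; rewrite -lowP1E//; apply: Rintegral_ge0 => y _; exact: lowP_ge0.
Qed.

Lemma upprim1_ge0 x : 0 < x -> 0 <= U1 x.
Proof.
by move=> x0; rewrite -upP1E//; apply: Rintegral_ge0 => y _; exact: upP_ge0.
Qed.

Lemma integral_lowprim1 x : 0 < x ->
  (\int[mu]_(u in `[0%R, x]) (L1 u)%:E = (L2 x)%:E)%E.
Proof.
move=> x0.
apply: (integral_FTC_from0 x0 lowprim1_continuous is_derive_lowprim2).
- by rewrite lowprim1_0; exact: lowprim1_cvg0.
- exact: lowprim2_cvg0.
- exact: lowprim2_0.
Qed.

Lemma integral_upprim1 x : 0 < x ->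
  (\int[mu]_(u in `[x, +oo[) (U1 u)%:E = (U2 x)%:E)%E.
Proof.
move=> x0; apply: (integral_FTC_toy0 x0 upprim1_continuous is_derive_upprim2) => //.
by move=> y xy; apply/upprim1_ge0/(lt_le_trans x0).
Qed.

Lemma lowprim2_ge0 x : 0 <= x -> 0 <= L2 x.
Proof.
rewrite le_eqVlt => /predU1P[<-|x0]; first by rewrite lowprim2_0.
rewrite -lee_fin -integral_lowprim1//; apply: integral_ge0 => y.
by rewrite /= in_itv/= => /andP[y0 _]; rewrite lee_fin lowprim1_ge0.
Qed.

Lemma upprim2_ge0 x : 0 < x -> 0 <= U2 x.
Proof.
move=> x0; rewrite -lee_fin -integral_upprim1//; apply: integral_ge0 => y.
rewrite /= in_itv/= andbT => xy; rewrite lee_fin upprim1_ge0//.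
exact: lt_le_trans xy.
Qed.

(** Integration by parts: (x - u) L1 + L2 is a primitive that vanishes at 0 and reduces to L2 at u =
    x. The weight x - u is the majorant of a 1-Lipschitz increment. *)
Lemma integral_lowP_moment x : 0 < x ->
  (\int[mu]_(u in `[0%R, x]) ((x - u) * P u)%:E = (L2 x)%:E)%E.
Proof.
move=> x0; pose F (u : R) : R := (-1 * u + x) * L1 u + L2 u.
have DF (u : R) : 0 < u -> is_derive u 1 F ((x - u) * P u).
  move=> u0; have DL1 := is_derive_lowprim1 u0; have DL2 := is_derive_lowprim2 u0.
  by apply: is_derive_eq; rewrite /GRing.scale/=; ring.
rewrite (integral_FTC_from0 (F := F) x0)//.
- by congr EFin; rewrite /F; ring.
- move=> u u0; apply: cvgM; last exact: lowP_continuous.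
  by apply: cvgB; [exact: cvg_cst|exact: cvg_id].
- rewrite lowP0 mulr0.
  have -> : (fun u => (x - u) * P u) = (fun u => (-1 * u + x) * P u).
    by apply/funext => u; ring.
  by apply: cvg_at0rM0; [exact: affine_continuous|exact: lowP_cvg0].
- apply: cvg_at0rD0; last exact: lowprim2_cvg0.
  by apply: cvg_at0rM0; [exact: affine_continuous|exact: lowprim1_cvg0].
- by rewrite /F lowprim1_0 lowprim2_0 mulr0 addr0.
Qed.

(** The mirror integration by parts; the boundary term at infinity vanishes because U1 decays faster
    than u. *)
Lemma integral_upP_moment x : 0 < x ->
  (\int[mu]_(u in `[x, +oo[) ((u - x) * Q u)%:E = (U2 x)%:E)%E.
Proof.
move=> x0; pose F (u : R) : R := (u - x) * U1 u + U2 u.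
have DF (u : R) : 0 < u -> is_derive u 1 F (- ((u - x) * Q u)).
  move=> u0; have DU1 := is_derive_upprim1 u0; have DU2 := is_derive_upprim2 u0.
  by apply: is_derive_eq; rewrite /GRing.scale/=; ring.
rewrite (integral_FTC_toy0 (F := F) x0)//.
- by rewrite /F subrr mul0r add0r.
- move=> u u0; apply: cvgM; last exact: upP_continuous.
  by apply: cvgB; [exact: cvg_id|exact: cvg_cst].
- by move=> u xu; rewrite mulr_ge0 ?subr_ge0 ?upP_ge0.
- have -> : F = (fun u => u ^+ 1 * U1 u + (- x * (u ^+ 0 * U1 u) + 1 * (u ^+ 0 * U2 u))).
    by apply/funext => u; rewrite /F expr0 expr1; ring.
  apply: cvgyD0; first exact: xXupprim1_cvgy.
  by apply: cvgyD0; apply: cvgyZ0; [exact: xXupprim1_cvgy|exact: xXupprim2_cvgy].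
Qed.

Lemma lowprim3_ge0 x : 0 < x -> 0 <= L3 x.
Proof.
move=> x0; rewrite -lee_fin.
rewrite -(integral_FTC_from0 x0 lowprim2_continuous is_derive_lowprim3).
- apply: integral_ge0 => y; rewrite /= in_itv/= => /andP[y0 _].
  by rewrite lee_fin lowprim2_ge0.
- by rewrite lowprim2_0; exact: lowprim2_cvg0.
- exact: lowprim3_cvg0.
- exact: lowprim3_0.
Qed.

Lemma upprim3_ge0 x : 0 < x -> 0 <= U3 x.
Proof.
move=> x0; rewrite -lee_fin.
have U2_ge0 y : x <= y -> 0 <= U2 y.
  by move=> xy; apply/upprim2_ge0/(lt_le_trans x0).
rewrite -(integral_FTC_toy0 x0 upprim2_continuous is_derive_upprim3)//.
  apply: integral_ge0 => y; rewrite /= in_itv/= andbT => xy.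
  by rewrite lee_fin U2_ge0.
exact: upprim3_cvgy.
Qed.

Lemma Rintegral_lowP1 x : 0 < x -> \int[mu]_(u in `[0, x]) lowP1 a b u = L2 x.
Proof.
move=> x0; rewrite /Rintegral -[RHS]/(fine (L2 x)%:E) -integral_lowprim1//.
congr fine; apply: eq_integral => u; rewrite inE/= in_itv/= => /andP[u0 _].
by rewrite lowP1E.
Qed.

Lemma Rintegral_upP1 x : 0 < x -> \int[mu]_(u in `[x, +oo[) upP1 a b u = U2 x.
Proof.
move=> x0; rewrite /Rintegral -[RHS]/(fine (U2 x)%:E) -integral_upprim1//.
congr fine; apply: eq_integral => u; rewrite inE/= in_itv/= andbT => xu.
by rewrite upP1E// (lt_le_trans x0).
Qed.

(** By conversion [lowM] and [upM] are [mratio] at [lowP] and [upP]; the sign [s = -1] makes the odd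
    derivatives of [upM] negative multiples of its primitives. *)
Lemma derive1_lowM (x : R) : 0 < x ->
  derive1 (lowM a b) x = L1 x / (b * x * q x).
Proof.
by move=> x0; have := derive1_mratio b0 sqr1 p0 Dp DP x0; rewrite mul1r.
Qed.

Lemma derive2_lowM (x : R) : 0 < x ->
  derive1n 2 (lowM a b) x = 2 * L2 x / ((b * x) ^+ 2 * q x).
Proof. exact: (derive2_mratio b0 sqr1 p0 Dp DP). Qed.

Lemma derive3_lowM (x : R) : 0 < x ->
  derive1n 3 (lowM a b) x = 6 * L3 x / ((b * x) ^+ 3 * q x).
Proof.
by move=> x0; have := derive3_mratio b0 sqr1 p0 Dp DP x0; rewrite mulr1.
Qed.

Lemma derive1_upM (x : R) : 0 < x ->
  derive1 (upM a b) x = - (U1 x / (b * x * q x)).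
Proof.
move=> x0; have := derive1_mratio b0 sqrN1 p0 Dp DQ x0.
by rewrite mulN1r mulNr.
Qed.

Lemma derive2_upM (x : R) : 0 < x ->
  derive1n 2 (upM a b) x = 2 * U2 x / ((b * x) ^+ 2 * q x).
Proof. exact: (derive2_mratio b0 sqrN1 p0 Dp DQ). Qed.

Lemma derive3_upM (x : R) : 0 < x ->
  derive1n 3 (upM a b) x = - (6 * U3 x / ((b * x) ^+ 3 * q x)).
Proof.
move=> x0; have := derive3_mratio b0 sqrN1 p0 Dp DQ x0.
by rewrite mulrN1 !mulNr.
Qed.

Let upPE x : 0 < x -> Q x = 1 - P x.
Proof. by move=> x0; rewrite -(lowP_upP mass1 (ltW x0)) addrAC subrr add0r. Qed.

(** In Q L1 + P U1 the terms (x - a b) P Q cancel, and P + Q = 1 leaves q. *)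
Lemma ratio_sum0 x : 0 < x -> upM a b x * L1 x + lowM a b x * U1 x = 1.
Proof.
move=> x0; rewrite /upM /lowM upPE// /prim1 upPE//.
by field; rewrite !gt_eqF ?p0.
Qed.

(** By the recurrence, the L1 U1 terms of 2 (U2 L1 + L2 U1) cancel, leaving b x (Q L1 + P U1) = b x
    q. *)
Lemma ratio_sum2 x : 0 < x ->
  derive1n 2 (upM a b) x * L1 x + derive1n 2 (lowM a b) x * U1 x = (b * x)^-1.
Proof.
move=> x0; rewrite derive2_upM// derive2_lowM// /prim2 /prim1 upPE//.
by field; rewrite !gt_eqF ?p0.
Qed.

(** The same cancellation one stage later: 3 (U3 L2 + L3 U2) reduces to b x (U1 L2 + L1 U2), which
    is known from the previous sum. *)
Lemma ratio_sum3 x : 0 < x ->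
  - derive1n 3 (upM a b) x * L2 x + derive1n 3 (lowM a b) x * U2 x = (b * x)^-1.
Proof.
move=> x0; rewrite derive3_upM// derive3_lowM// /prim3 /prim2 /prim1 upPE//.
by field; rewrite !gt_eqF ?p0.
Qed.

(** The two summands of [C1] coincide, hence the factor 2; those of [C2] coincide too, which gives
    the 4 below. *)
Lemma C1E x : 0 < x -> C1 a b x = 2 * L1 x * U1 x / (b * x * q x).
Proof.
move=> x0; rewrite /C1 derive1_upM// derive1_lowM// lowP1E ?ltW// upP1E//.
by field; rewrite !gt_eqF ?p0.
Qed.

Lemma C2E x : 0 < x -> C2 a b x = 4 * L2 x * U2 x / ((b * x) ^+ 2 * q x).
Proof.
move=> x0; rewrite /C2 derive2_upM// derive2_lowM//.
rewrite Rintegral_lowP1// Rintegral_upP1//.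
by field; rewrite !gt_eqF ?p0.
Qed.

End gamma_primitives.

(** * Reduction of the constants to scale 1 *)

Section gamma_scaling.
Context {R : realType}.
Variables a b : R.
Hypotheses (a0 : 0 < a) (b0 : 0 < b).
Local Notation mu := (@lebesgue_measure R).
Hypothesis mass1 : (\int[mu]_u (gamma_pdf a b u)%:E = 1)%E.

Lemma gamma_pdf_scale x : gamma_pdf a 1 x = b * gamma_pdf a b (b * x).
Proof.
have [x0|x0] := leP x 0.
  by rewrite !gamma_pdf_le0 ?mulr0// pmulr_rle0.
rewrite !gamma_pdfE ?mulr_gt0// powR1 divr1 mulr1 powRM ?ltW//.
rewrite (mulrC b x) mulfK ?gt_eqF//.
rewrite -(mulr_powRB1 (ltW b0) a0); field.
by rewrite !gt_eqF ?powR_gt0// (gamma_fun_gt0 mass1).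
Qed.

Let is_derive_lowP_scale (x : R) : 0 < x ->
  is_derive x 1 (fun y => lowP a b (b * y)) (gamma_pdf a 1 x).
Proof.
move=> x0; rewrite gamma_pdf_scale mulrC.
apply: (@is_derive1_comp _ (lowP a b) (fun y => b * y)).
  by apply: is_derive_lowP => //; rewrite mulr_gt0.
by apply: is_derive_eq; rewrite /GRing.scale/= mulr1.
Qed.

(** Uses the total mass at scale [b] only, that at scale 1 being still to be derived:
    [lowP a b (b * y)] is a primitive of the density of scale 1 and tends to 1. *)
Let integral_pdf1 x : 0 < x ->
  (\int[mu]_(u in `[x, +oo[) (gamma_pdf a 1 u)%:E = (1 - lowP a b (b * x))%:E)%E.
Proof.
move=> x0; apply: (integral_FTC_toy x0 _ is_derive_lowP_scale).
- by move=> y; exact: gamma_pdf_continuous.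
- by move=> y _; exact: gamma_pdf_ge0.
- apply: (cvg_comp _ _ _ (lowP_cvgy b0 mass1)).
  by apply: gt0_cvgMry => //; exact: cvg_id.
Qed.

(* The half-line is exhausted by [1/(n+1), +oo[ as the density blows up at 0
   when [a < 1]. *)
Lemma gamma_mass_scale : (\int[mu]_u (gamma_pdf a 1 u)%:E = 1)%E.
Proof.
pose D n : set R := `[(@harmonic R n), +oo[.
have DE : \bigcup_n D n = `]0, +oo[.
  apply/seteqP; split => [x [n _]|x]; rewrite /D /= !in_itv/= !andbT.
    by apply: lt_le_trans; rewrite invr_gt0.
  (* An integer above 1/x, so that 1/(n+1) <= x. *)
  move=> x0; exists (Num.bound x^-1) => //.
  rewrite /D /= in_itv/= andbT /harmonic invf_ple ?posrE//.
  rewrite (le_trans (ltW (archi_boundP _))) ?invr_ge0 ?ltW//.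
  by rewrite ltr_nat.
have -> : (\int[mu]_u (gamma_pdf a 1 u)%:E =
    \int[mu]_(u in \bigcup_n D n) (gamma_pdf a 1 u)%:E)%E.
  rewrite DE [RHS]integral_mkcond; apply: eq_integral => u _.
  rewrite patchE; case: ifPn => //; rewrite notin_setE/= in_itv/= andbT.
  by move/negP; rewrite -leNgt => /gamma_pdf_le0 ->.
have cvgD : (\int[mu]_(u in D n) (gamma_pdf a 1 u)%:E)%E @[n --> \oo] -->
    (\int[mu]_(u in \bigcup_n D n) (gamma_pdf a 1 u)%:E)%E.
  apply: ge0_nondecreasing_set_cvg_integral => //.
  - apply/nondecreasing_seqP => n; rewrite subsetEset; apply: subset_itvr.
    by rewrite bnd_simp lef_pV2 ?posrE// ler_nat.
  - by move=> n; exact: measurable_itv.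
  - by move=> n; apply/measurable_EFinP/measurable_funTS; exact: measurable_gamma_pdf.
  - by move=> n u _; rewrite lee_fin gamma_pdf_ge0.
apply: cvg_unique cvgD _ => //.
have -> : (fun n => \int[mu]_(u in D n) (gamma_pdf a 1 u)%:E)%E =
    (fun n => (1 - lowP a b (b * harmonic n))%:E).
  by apply/funext => n; rewrite integral_pdf1// invr_gt0.
apply: cvg_EFin; first by near=> n.
apply: cvgr_eq (subr0 1); apply: cvgB; first exact: cvg_cst.
have /cvg_at_rightP := lowP_cvg0 mass1; apply; split.
  by move=> n; rewrite mulr_gt0// invr_gt0.
by apply: cvgr_eq (mulr0 b); apply: cvgM; [exact: cvg_cst|exact: cvg_harmonic].
Unshelve. all: by end_near. Qed.

Lemma upP_scale x : 0 < x -> upP a 1 x = upP a b (b * x).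
Proof.
move=> x0; rewrite {1}/upP /Rintegral integral_pdf1//=.
by rewrite -(lowP_upP mass1 (x := b * x)) ?mulr_ge0 ?ltW// addrAC subrr add0r.
Qed.

Lemma lowP_scale x : 0 < x -> lowP a 1 x = lowP a b (b * x).
Proof.
move=> x0; have bx0 : 0 <= b * x by rewrite mulr_ge0 ?ltW.
apply: (addIr (upP a 1 x)); rewrite (lowP_upP gamma_mass_scale (ltW x0)).
by rewrite upP_scale// (lowP_upP mass1 bx0).
Qed.

(** From scale b at x to scale 1 at x/b, each of L1 and U1 is divided by b and the denominator of
    [C1E] by b^3. In [C2_scale] the divisors are b^2 and b^5. *)
Lemma C1_scale x : 0 < x -> C1 a b x = b^-1 * C1 a 1 (x / b).
Proof.
move=> x0; have xb0 : 0 < x / b by rewrite divr_gt0.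
rewrite (C1E a0 b0 mass1 x0) (C1E a0 ltr01 gamma_mass_scale xb0).
rewrite /prim1 lowP_scale// upP_scale// gamma_pdf_scale.
rewrite [b * (x / b)]mulrC divfK ?gt_eqF//.
have px0 := gamma_pdf_gt0 b0 mass1 x0.
by field; rewrite !gt_eqF.
Qed.

Lemma C2_scale x : 0 < x -> C2 a b x = b^-1 * C2 a 1 (x / b).
Proof.
move=> x0; have xb0 : 0 < x / b by rewrite divr_gt0.
rewrite (C2E a0 b0 mass1 x0) (C2E a0 ltr01 gamma_mass_scale xb0).
rewrite /prim2 /prim1 lowP_scale// upP_scale// gamma_pdf_scale.
rewrite [b * (x / b)]mulrC divfK ?gt_eqF//.
have px0 := gamma_pdf_gt0 b0 mass1 x0.
by field; rewrite !gt_eqF.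
Qed.

End gamma_scaling.

(** * Integration against a measure given by a density *)

Section density.
Context {R : realType}.
Local Notation mu := (@lebesgue_measure R).
Variables (nu : {finite_measure set (measurableTypeR R) -> \bar R}) (p : R -> R).
Hypothesis mp : measurable_fun setT p.
Hypothesis nuE : forall A : set (measurableTypeR R), measurable A ->
  nu A = (\int[mu]_(u in A) (p u)%:E)%E.

(** The formula holds for the Radon-Nikodym derivative, and [p] equals it almost everywhere because
    both have the same integral over every measurable set. *)
Lemma ge0_integral_density (f : measurableTypeR R -> \bar R) :
  measurable_fun setT f -> (forall u, 0 <= f u)%E ->
  (\int[nu]_u f u = \int[mu]_u (f u * (p u)%:E))%E.
Proof.
move=> mf f0; have mEp : measurable_fun setT (EFin \o p) by apply/measurable_EFinP.
have dom : nu `<< mu.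
  apply/null_content_dominatesP => A mA muA0; rewrite nuE//.
  by apply: null_set_integral => //; exact: measurable_funTS.
rewrite -(Radon_Nikodym_SigmaFinite.change_of_variables dom f0)//.
apply: ae_eq_integral => //.
- apply: emeasurable_funM => //.
  exact: (measurable_int mu (Radon_Nikodym_SigmaFinite.f_integrable dom)).
- exact: emeasurable_funM.
- apply: ae_eqe_mul2l; apply: integral_ae_eq => //.
  + exact: Radon_Nikodym_SigmaFinite.f_integrable.
  + move=> E _ mE; rewrite -Radon_Nikodym_SigmaFinite.f_integral//.
    exact: nuE.
Qed.

End density.

(** * Expectations under the Gamma law, cut at 0 and at [x] *)

Section gamma_expectation.
Context {R : realType} {d : measure_display} {T : measurableType d}.
Variables (P : probability T R) (X : {RV P >-> R}) (a b : R).
Hypotheses (a0 : 0 < a) (b0 : 0 < b) (hX : gamma_distributed X a b).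
Local Notation mu := (@lebesgue_measure R).
Local Notation p := (gamma_pdf a b).

(** Supplies the hypothesis [mass1] of the earlier sections: the law of [X] is a probability,
    evaluated here on the whole line. *)
Lemma gamma_distributed_mass : (\int[mu]_u (p u)%:E = 1)%E.
Proof. by apply: esym; rewrite -(probability_setT (distribution P X)); exact: hX. Qed.

Let p0 := gamma_pdf_gt0 b0 gamma_distributed_mass.

Lemma ge0_integral_gamma_distributed (f : R -> \bar R) :
  measurable_fun setT f -> (forall u, 0 <= f u)%E ->
  (\int[P]_w f (X w) = \int[mu]_u (f u * (p u)%:E))%E.
Proof.
move=> mf f0.
(* The random variable is retyped because the Lebesgue measure lives on
   [measurableTypeR R], whose display is not the default one. *)
have mX : @measurable_fun _ _ T (measurableTypeR R) setT X.
  exact: (@measurable_funPT _ _ _ _ X).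
pose Y : {mfun T >-> measurableTypeR R} :=
  @mfun_Sub _ _ T (measurableTypeR R) X (mem_set mX).
rewrite -(@ge0_integral_density _ (distribution P Y))//.
- by rewrite ge0_integral_distribution.
- exact: measurable_gamma_pdf.
Qed.

Section split.
Variables (x : R) (g A B : R -> R).
Hypotheses (x0 : 0 < x) (g_le0 : forall u, u <= 0 -> g u = 0).
Hypothesis gA : forall u, 0 < u -> u <= x -> g u = A u.
Hypothesis gB : forall u, x < u -> g u = B u.
Hypothesis cA : forall u : R, 0 < u -> {for u, continuous A}.
Hypothesis cB : forall u : R, 0 < u -> {for u, continuous B}.

Let low_pos : `]0, x] `<=` `]0, +oo[%classic.
Proof. by move=> u /=; rewrite !in_itv/= => /andP[->]. Qed.

Let up_pos : `]x, +oo[ `<=` `]0, +oo[%classic.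
Proof. by move=> u /=; rewrite !in_itv/= !andbT => /(lt_trans x0). Qed.

Lemma measurable_split : measurable_fun setT g.
Proof.
have -> : [set: R] = `]-oo, 0] `|` (`]0, x] `|` `]x, +oo[).
  apply/seteqP; split => // u _ /=; rewrite !in_itv/= andbT.
  have [u0|u0] := leP u 0; first by left.
  by right; have [ux|ux] := leP u x; [left|right].
apply/measurable_funU => //; first exact: measurableU.
split; last (apply/measurable_funU => //; split).
- apply: (eq_measurable_fun (cst (0 : R))) => // u.
  by rewrite inE/= in_itv/= => u0; rewrite g_le0.
- apply: (eq_measurable_fun A); last exact: measurable_gt0_continuous.
  by move=> u; rewrite inE/= in_itv/= => /andP[u0 ux]; rewrite gA.
- apply: (eq_measurable_fun B); last exact: measurable_gt0_continuous.
  by move=> u; rewrite inE/= in_itv/= andbT => ux; rewrite gB.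
Qed.

Lemma ge0_integral_split : (forall u, 0 <= g u) ->
  (\int[P]_w (g (X w))%:E = \int[mu]_(u in `]0%R, x]) (A u * p u)%:E +
    \int[mu]_(u in `]x, +oo[) (B u * p u)%:E)%E.
Proof.
move=> g0; have mg := measurable_split.
have mgp : measurable_fun setT (fun u => (g u * p u)%:E).
  apply/measurable_EFinP; apply: measurable_funM => //.
  exact: measurable_gamma_pdf.
rewrite (ge0_integral_gamma_distributed (f := EFin \o g))//; last first.
  by apply/measurable_EFinP.
transitivity (\int[mu]_(u in `]0%R, x] `|` `]x, +oo[) (g u * p u)%:E)%E.
  rewrite [RHS]integral_mkcond; apply: eq_integral => u _.
  rewrite patchE; case: ifPn => //=; rewrite notin_setE/= !in_itv/= andbT => ux.
  rewrite g_le0 ?mul0e//; rewrite leNgt; apply/negP => u0; apply: ux.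
  by rewrite u0; have [|] := leP u x; [left|right].
rewrite ge0_integral_setU//; last 3 first.
- exact: measurable_funS mgp.
- by move=> u _; rewrite lee_fin mulr_ge0 ?gamma_pdf_ge0.
- rewrite disj_set2E; apply/eqP/seteqP; split => // u [] /=.
  by rewrite !in_itv/= andbT => /andP[_ ux]; rewrite ltNge ux.
congr (_ + _)%E; apply: eq_integral => u; rewrite inE/= in_itv/=.
  by move=> /andP[u0 ux]; rewrite gA.
by rewrite andbT => ux; rewrite gB.
Qed.

End split.

End gamma_expectation.

(** * A general bound for expectations of weighted kernels *)

Section kernel_expectation.
Context {R : realType} {d : measure_display} {T : measurableType d}.
Variables (P : probability T R) (X : {RV P >-> R}) (a b : R).
Hypotheses (a0 : 0 < a) (b0 : 0 < b) (hX : gamma_distributed X a b).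
Local Notation mu := (@lebesgue_measure R).
Local Notation p := (gamma_pdf a b).
Variable x : R.
Hypothesis x0 : 0 < x.

Let mass1 := gamma_distributed_mass hX.
Let p0 := gamma_pdf_gt0 b0 mass1.

Let pV_continuous (u : R) : 0 < u -> {for u, continuous (fun u => (p u)^-1)}.
Proof.
move=> u0; apply: cvgV; first by rewrite gt_eqF ?p0.
exact: gamma_pdf_continuous.
Qed.

(** On each side of [x] the density cancels the [p u] in the denominator of the kernel, leaving a
    constant times |w f|, dominated by [F1] or [F2]. The same estimate yields the integrability
    needed to split expectations. *)
Lemma kernel_expectation_le (g w f1 f2 F1 F2 : R -> R) (al be A B : R) :
  (forall u, u <= 0 -> g u = 0) ->
  (forall u, 0 < u -> u <= x -> g u = w u * (al * (f1 u / p u))) ->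
  (forall u, x < u -> g u = w u * (be * (f2 u / p u))) ->
  (forall u : R, 0 < u -> {for u, continuous w}) ->
  (forall u : R, 0 < u -> {for u, continuous f1}) ->
  (forall u : R, 0 < u -> {for u, continuous f2}) ->
  (forall u : R, 0 < u -> {for u, continuous F1}) ->
  (forall u : R, 0 < u -> {for u, continuous F2}) ->
  (forall u, 0 < u -> u <= x -> `|w u * f1 u| <= F1 u) ->
  (forall u, x < u -> `|w u * f2 u| <= F2 u) ->
  (\int[mu]_(u in `[0%R, x]) (F1 u)%:E = A%:E)%E ->
  (\int[mu]_(u in `[x, +oo[) (F2 u)%:E = B%:E)%E ->
  P.-integrable setT (fun z => (g (X z))%:E) /\
  (`|'E_P[fun z => g (X z)]| <= (`|al| * A + `|be| * B)%:E)%E.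
Proof.
move=> g_le0 g1 g2 cw cf1 cf2 cF1 cF2 wF1 wF2 intF1 intF2.
have cE (f : R -> R) (c : R) : (forall u : R, 0 < u -> {for u, continuous f}) ->
    forall u : R, 0 < u -> {for u, continuous (fun u => w u * (c * (f u / p u)))}.
  move=> cf u u0; apply: cvgM; first exact: cw.
  apply: cvgM; first exact: cvg_cst.
  by apply: cvgM; [exact: cf|exact: pV_continuous].
have mg := measurable_split x0 g_le0 g1 g2 (cE f1 al cf1) (cE f2 be cf2).
have mgX : measurable_fun setT (fun z => (g (X z))%:E).
  by apply/measurable_EFinP; exact: (measurableT_comp mg).
have normE (f : R -> R) (c : R) u : 0 < u ->
    `|w u * (c * (f u / p u))| * p u = `|c| * `|w u * f u|.
  move=> u0; rewrite !normrM normfV (gtr0_norm (p0 u0)).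
  by field; rewrite gt_eqF ?p0.
have le_gX : (\int[P]_z `|(g (X z))%:E| <= (`|al| * A + `|be| * B)%:E)%E.
  have cN (f : R -> R) : (forall u : R, 0 < u -> {for u, continuous f}) ->
      forall u : R, 0 < u -> {for u, continuous (fun u => `|f u|)}.
    by move=> cf u u0; apply: cvg_norm; exact: cf.
  have split := @ge0_integral_split _ _ _ P X a b hX x
    (fun u => `|g u|) (fun u => `|w u * (al * (f1 u / p u))|)
    (fun u => `|w u * (be * (f2 u / p u))|) x0.
  rewrite /= split//; last 5 first.
  - by move=> u u0; rewrite g_le0// normr0.
  - by move=> u u0 ux; rewrite g1.
  - by move=> u xu; rewrite g2.
  - exact/cN/cE.
  - exact/cN/cE.
  have mF1 : measurable_fun `]0, x] (fun u => (F1 u)%:E).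
    apply/measurable_EFinP; apply: measurable_gt0_continuous => // u /=.
    by rewrite !in_itv/= => /andP[->].
  have mF2 : measurable_fun `]x, +oo[ (fun u => (F2 u)%:E).
    apply/measurable_EFinP; apply: measurable_gt0_continuous => // u /=.
    by rewrite !in_itv/= !andbT; exact: lt_trans.
  rewrite EFinD; apply: leeD.
  (* The null endpoint 0 is dropped, since [wF1] speaks of positive points only. *)
  - rewrite EFinM -intF1 -integral_itv_obnd_cbnd// -ge0_integralZl_EFin//; last first.
      move=> u /=; rewrite in_itv/= => /andP[u0 ux].
      by rewrite lee_fin (le_trans _ (wF1 u u0 ux)).
    apply: ge0_le_integral => //.
    + by move=> u _; rewrite lee_fin mulr_ge0 ?gamma_pdf_ge0.
    + apply/measurable_EFinP; apply: measurable_gt0_continuous => //.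
        by move=> u /=; rewrite !in_itv/= => /andP[->].
      move=> u u0; apply: cvgM; last exact: gamma_pdf_continuous.
      exact: (cN _ (cE f1 al cf1) u u0).
    + by apply: measurable_funeM.
    + move=> u /=; rewrite in_itv/= => /andP[u0 ux].
      by rewrite lee_fin normE// ler_wpM2l// wF1.
  - rewrite EFinM -intF2 -integral_itv_obnd_cbnd// -ge0_integralZl_EFin//; last first.
      move=> u /=; rewrite in_itv/= andbT => ux.
      by rewrite lee_fin (le_trans _ (wF2 u ux)).
    apply: ge0_le_integral => //.
    + by move=> u _; rewrite lee_fin mulr_ge0 ?gamma_pdf_ge0.
    + apply/measurable_EFinP; apply: measurable_gt0_continuous => //.
        by move=> u /=; rewrite !in_itv/= !andbT; exact: lt_trans.
      move=> u u0; apply: cvgM; last exact: gamma_pdf_continuous.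
      exact: (cN _ (cE f2 be cf2) u u0).
    + by apply: measurable_funeM.
    + move=> u /=; rewrite in_itv/= andbT => ux.
      by rewrite lee_fin normE ?ler_wpM2l ?wF2// (lt_trans x0).
split.
  by apply/integrableP; split => //; apply: le_lt_trans le_gX _; rewrite ltry.
by rewrite unlock; apply: le_trans le_gX; exact: le_abse_integral.
Qed.

End kernel_expectation.

(** * Values of the kernels on either side of the jump *)

Section kernel_values.
Context {R : realType}.
Variables (a b : R).
Local Notation p := (gamma_pdf a b).

(* Stated for arbitrary coefficients because simplifying the kernels in place
   makes unification unfold the derivatives of the ratios. *)
Let split_low (c1 c2 l1 l2 u x : R) : u <= x ->
  c1 * l1 * (u <= x)%R%:R - c2 * l2 * (x < u)%R%:R = c1 * l1.
Proof. by move=> ux; rewrite ux ltNge ux mulr1 mulr0 subr0. Qed.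

Let split_up (c1 c2 l1 l2 u x : R) : x < u ->
  c1 * l1 * (u <= x)%R%:R - c2 * l2 * (x < u)%R%:R = - c2 * l2.
Proof. by move=> ux; rewrite ux leNgt ux mulr1 mulr0 add0r mulNr. Qed.

Let split0 (c1 c2 l1 l2 d t1 t2 : R) : d = 0 ->
  c1 * (l1 / d) * t1 - c2 * (l2 / d) * t2 = 0.
Proof. by move=> ->; rewrite invr0 !mulr0 !mul0r subr0. Qed.

Lemma K1_le0 k u x : u <= 0 -> K1 a b k u x = 0.
Proof. by move=> u0; exact/split0/gamma_pdf_le0. Qed.

Lemma K1_low k u x : u <= x ->
  K1 a b k u x = - derive1n k (upM a b) x * (lowP a b u / p u).
Proof. exact: split_low. Qed.

Lemma K1_up k u x : x < u ->
  K1 a b k u x = - derive1n k (lowM a b) x * (upP a b u / p u).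
Proof. exact: split_up. Qed.

Lemma K32_le0 u x : u <= 0 -> K32 a b u x = 0.
Proof. by move=> u0; exact/split0/gamma_pdf_le0. Qed.

Lemma K32_low u x : u <= x ->
  K32 a b u x = derive1n 3 (upM a b) x * (lowP1 a b u / p u).
Proof. exact: split_low. Qed.

Lemma K32_up u x : x < u ->
  K32 a b u x = - derive1n 3 (lowM a b) x * (upP1 a b u / p u).
Proof. exact: split_up. Qed.

End kernel_values.

(** * Bounds on the solution and on its derivatives *)

Section stein_bounds.
Context {R : realType} {d : measure_display} {T : measurableType d}.
Variables (P : probability T R) (X : {RV P >-> R}) (a b : R).
Hypotheses (a0 : 0 < a) (b0 : 0 < b) (hX : gamma_distributed X a b).
Local Notation mu := (@lebesgue_measure R).
Local Notation p := (gamma_pdf a b).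
Local Notation L1 := (prim1 a b 1 p (lowP a b)).
Local Notation L2 := (prim2 a b 1 p (lowP a b)).
Local Notation U1 := (prim1 a b (-1) p (upP a b)).
Local Notation U2 := (prim2 a b (-1) p (upP a b)).

Let mass1 := gamma_distributed_mass hX.
Let p0 := gamma_pdf_gt0 b0 mass1.

(** The majorants stay free to serve twice: [lowP] and [upP] themselves for weights bounded by 1,
    and their products with |u - x| for Lipschitz increments. *)
Lemma expectation_K1_le k (w F1 F2 : R -> R) (A B x : R) : 0 < x ->
  (forall u : R, 0 < u -> {for u, continuous w}) ->
  (forall u : R, 0 < u -> {for u, continuous F1}) ->
  (forall u : R, 0 < u -> {for u, continuous F2}) ->
  (forall u, 0 < u -> u <= x -> `|w u| * lowP a b u <= F1 u) ->
  (forall u, x < u -> `|w u| * upP a b u <= F2 u) ->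
  (\int[mu]_(u in `[0%R, x]) (F1 u)%:E = A%:E)%E ->
  (\int[mu]_(u in `[x, +oo[) (F2 u)%:E = B%:E)%E ->
  P.-integrable setT (fun z => (w (X z) * K1 a b k (X z) x)%:E) /\
  (`|'E_P[fun z => (w (X z) * K1 a b k (X z) x)%R]| <=
   (`|derive1n k (upM a b) x| * A + `|derive1n k (lowM a b) x| * B)%:E)%E.
Proof.
move=> x0 cw cF1 cF2 wF1 wF2 intF1 intF2.
rewrite -(normrN (derive1n k (upM _ _) _)) -(normrN (derive1n k (lowM _ _) _)).
apply: (kernel_expectation_le b0 hX x0 (g := fun u => w u * K1 a b k u x)
  (w := w) (f1 := lowP a b) (f2 := upP a b) (F1 := F1) (F2 := F2)) => //.
- by move=> u u0; rewrite K1_le0 ?mulr0.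
- by move=> u u0 ux; rewrite K1_low.
- by move=> u ux; rewrite K1_up.
- by move=> u; exact: lowP_continuous.
- by move=> u; exact: upP_continuous.
- by move=> u u0 ux; rewrite normrM (ger0_norm (lowP_ge0 _ _ _)) wF1.
- by move=> u ux; rewrite normrM (ger0_norm (upP_ge0 _ _ _)) wF2.
Qed.

Lemma expectation_K32_le (w : R -> R) (x al be : R) : 0 < x ->
  derive1n 3 (upM a b) x = al -> derive1n 3 (lowM a b) x = be ->
  (forall u : R, 0 < u -> {for u, continuous w}) ->
  (forall u, 0 < u -> `|w u| <= 1) ->
  (`|'E_P[fun z => (w (X z) * K32 a b (X z) x)%R]| <=
   (`|al| * L2 x + `|be| * U2 x)%:E)%E.
Proof.
move=> x0 alE beE cw w1; rewrite -(normrN be).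
apply: (kernel_expectation_le b0 hX x0 (g := fun u => w u * K32 a b u x)
  (w := w) (f1 := L1) (f2 := U1) (F1 := L1) (F2 := U1) _ _ _ _ _ _ _ _ _ _
  (integral_lowprim1 a0 b0 mass1 x0) (integral_upprim1 a0 b0 mass1 x0)).2 => //.
- by move=> u u0; rewrite K32_le0 ?mulr0.
- by move=> u u0 ux; rewrite K32_low// alE lowP1E// ltW.
- by move=> u ux; rewrite K32_up// beE upP1E// (lt_trans x0).
- by move=> u; exact: lowprim1_continuous.
- by move=> u; exact: upprim1_continuous.
- by move=> u; exact: lowprim1_continuous.
- by move=> u; exact: upprim1_continuous.
- move=> u u0 ux; have L1u : 0 <= L1 u by rewrite lowprim1_ge0// ltW.
  by rewrite normrM (ger0_norm L1u) ler_piMl// w1.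
- move=> u xu; have u0 := lt_trans x0 xu; have U1u : 0 <= U1 u by rewrite upprim1_ge0.
  by rewrite normrM (ger0_norm U1u) ler_piMl// w1.
Qed.

Lemma expectation_K1_le1 k (w : R -> R) (x : R) : 0 < x ->
  (forall u : R, 0 < u -> {for u, continuous w}) ->
  (forall u, 0 < u -> `|w u| <= 1) ->
  P.-integrable setT (fun z => (w (X z) * K1 a b k (X z) x)%:E) /\
  (`|'E_P[fun z => (w (X z) * K1 a b k (X z) x)%R]| <=
   (`|derive1n k (upM a b) x| * L1 x + `|derive1n k (lowM a b) x| * U1 x)%:E)%E.
Proof.
move=> x0 cw w1; apply: (expectation_K1_le k x0 cw _ _ _ _
  (integral_lowP a0 b0 mass1 x0) (integral_upP a0 b0 mass1 x0)) => u.
- exact: lowP_continuous.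
- exact: upP_continuous.
- by move=> u0 _; rewrite ler_piMl ?lowP_ge0// w1.
- by move=> xu; rewrite ler_piMl ?upP_ge0// w1// (lt_trans x0).
Qed.

Lemma derive2_upM_ge0 x : 0 < x -> 0 <= derive1n 2 (upM a b) x.
Proof.
move=> x0; rewrite derive2_upM// divr_ge0//.
  by rewrite mulr_ge0// upprim2_ge0.
by rewrite !mulr_ge0 ?exprn_ge0 ?mulr_ge0 ?gamma_pdf_ge0// ltW.
Qed.

Lemma derive2_lowM_ge0 x : 0 < x -> 0 <= derive1n 2 (lowM a b) x.
Proof.
move=> x0; rewrite derive2_lowM// divr_ge0//.
  by rewrite mulr_ge0// lowprim2_ge0// ltW.
by rewrite !mulr_ge0 ?exprn_ge0 ?mulr_ge0 ?gamma_pdf_ge0// ltW.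
Qed.

(** The kernel has constant sign, so its integral is computed exactly, without loss, and equals
    minus the left side of [ratio_sum2]. *)
Lemma expectation_K1_2 (x : R) : 0 < x ->
  ('E_P[fun z => K1 a b 2 (X z) x] = (- (b * x)^-1)%:E)%E.
Proof.
(* Opaque names keep unification from unfolding the second derivatives. *)
move=> x0; have [al alE] : {al | derive1n 2 (upM a b) x = al} by eexists.
have [be beE] : {be | derive1n 2 (lowM a b) x = be} by eexists.
have bx0 : 0 < b * x by rewrite mulr_gt0.
have al0 : 0 <= al by rewrite -alE derive2_upM_ge0.
have be0 : 0 <= be by rewrite -beE derive2_lowM_ge0.
have cP (f : R -> R) (c : R) : (forall u : R, 0 < u -> {for u, continuous f}) ->
    forall u : R, 0 < u -> {for u, continuous (fun u => c * (f u / p u))}.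
  move=> cf u u0; apply: cvgM; first exact: cvg_cst.
  apply: cvgM; first exact: cf.
  apply: cvgV; first by rewrite gt_eqF ?p0.
  exact: gamma_pdf_continuous.
have NK0 u : 0 <= - K1 a b 2 u x.
  have [u0|u0] := leP u 0; first by rewrite K1_le0 ?oppr0.
  have [ux|ux] := leP u x.
    by rewrite K1_low// alE mulNr opprK mulr_ge0// divr_ge0 ?lowP_ge0 ?gamma_pdf_ge0.
  by rewrite K1_up// beE mulNr opprK mulr_ge0// divr_ge0 ?upP_ge0 ?gamma_pdf_ge0.
have mlow : measurable_fun `]0, x] (fun u => (lowP a b u)%:E).
  apply/measurable_EFinP; apply: measurable_gt0_continuous => //.
    by move=> u /=; rewrite !in_itv/= => /andP[->].
  by move=> u; exact: lowP_continuous.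
have mup : measurable_fun `]x, +oo[ (fun u => (upP a b u)%:E).
  apply/measurable_EFinP; apply: measurable_gt0_continuous => //.
    by move=> u /=; rewrite !in_itv/= !andbT; exact: lt_trans.
  by move=> u; exact: upP_continuous.
have intNK : (\int[P]_z (- K1 a b 2 (X z) x)%:E = ((b * x)^-1)%:E)%E.
  have := @ge0_integral_split _ _ _ P X a b hX x (fun u => - K1 a b 2 u x)
    (fun u => al * (lowP a b u / p u)) (fun u => be * (upP a b u / p u)) x0.
  rewrite /= => ->//.
  - have := ratio_sum2 b0 mass1 x0; rewrite alE beE => <-.
    rewrite EFinD; congr (_ + _)%E.
    + rewrite EFinM -integral_lowP// -integral_itv_obnd_cbnd//.
      rewrite -ge0_integralZl_EFin//; last first.
        by move=> u _; rewrite lee_fin lowP_ge0.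
      apply: eq_integral => u; rewrite inE/= in_itv/= => /andP[u0 ux].
      by rewrite -EFinM -mulrA divfK ?gt_eqF ?p0.
    + rewrite EFinM -integral_upP// -integral_itv_obnd_cbnd//.
      rewrite -ge0_integralZl_EFin//; last first.
        by move=> u _; rewrite lee_fin upP_ge0.
      apply: eq_integral => u; rewrite inE/= in_itv/= andbT => ux.
      by rewrite -EFinM -mulrA divfK ?gt_eqF ?p0 ?(lt_trans x0).
  - by move=> u u0; rewrite K1_le0// oppr0.
  - by move=> u u0 ux; rewrite K1_low// alE mulNr opprK.
  - by move=> u ux; rewrite K1_up// beE mulNr opprK.
  - by apply: cP => u; exact: lowP_continuous.
  - by apply: cP => u; exact: upP_continuous.
rewrite unlock EFinN -intNK -integral_ge0N; last first.
  by move=> z _; rewrite lee_fin NK0.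
by apply: eq_integral => z _; rewrite EFinN oppeK.
Qed.

(** Mean value theorem on the segment between the two points, which stays in the positive
    half-line. *)
Lemma lipschitz_gt0 (f : R -> R) :
  (forall u : R, 0 < u -> derivable f u 1 /\ `|derive1 f u| <= 1) ->
  forall u v, 0 < u -> 0 < v -> `|f u - f v| <= `|u - v|.
Proof.
move=> Df u v; wlog uv : u v / v <= u => [hw|] u0 v0.
  have [vu|/ltW uv] := leP v u; first exact: hw.
  by rewrite distrC [leRHS]distrC; exact: hw.
have Dvu t : v <= t -> derivable f t 1 /\ `|derive1 f t| <= 1.
  by move=> vt; apply: Df; exact: lt_le_trans vt.
have [||t] := @MVT_segment _ f (derive1 f) v u uv.
- move=> t; rewrite in_itv/= => /andP[/ltW/Dvu[ft _] _].
  by rewrite derive1E; exact: derivableP.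
- apply: derivable_within_continuous => t.
  by rewrite in_itv/= => /andP[/Dvu[]].
- rewrite in_itv/= => /andP[/Dvu[_ ft] _] ->.
  by rewrite normrM ler_piMl.
Qed.

(** Centring [w] at [x] absorbs the added term; the moment integrals then turn the increments into
    L2 and U2, the integrals appearing in [C2]. *)
Lemma expectation_K1_2_lipschitz (w : R -> R) (x : R) : 0 < x ->
  (forall u : R, 0 < u -> {for u, continuous w}) ->
  (forall u v, 0 < u -> 0 < v -> `|w u - w v| <= `|u - v|) ->
  (`|'E_P[fun z => (w (X z) * K1 a b 2 (X z) x)%R] + (w x / (b * x))%:E| <=
   (C2 a b x)%:E)%E.
Proof.
move=> x0 cw lipw; have [al alE] : {al | derive1n 2 (upM a b) x = al} by eexists.
have [be beE] : {be | derive1n 2 (lowM a b) x = be} by eexists.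
have al0 : 0 <= al by rewrite -alE derive2_upM_ge0.
have be0 : 0 <= be by rewrite -beE derive2_lowM_ge0.
have wx u : 0 < u -> {for u, continuous (fun u => w u - w x)}.
  by move=> u0; apply: cvgB; [exact: cw|exact: cvg_cst].
have cF1 u : 0 < u -> {for u, continuous (fun u => (x - u) * lowP a b u)}.
  move=> u0; apply: cvgM; last exact: lowP_continuous.
  by apply: cvgB; [exact: cvg_cst|exact: cvg_id].
have cF2 u : 0 < u -> {for u, continuous (fun u => (u - x) * upP a b u)}.
  move=> u0; apply: cvgM; last exact: upP_continuous.
  by apply: cvgB; [exact: cvg_id|exact: cvg_cst].
have leF1 u : 0 < u -> u <= x -> `|w u - w x| * lowP a b u <= (x - u) * lowP a b u.
  move=> u0 ux; rewrite ler_wpM2r ?lowP_ge0// (le_trans (lipw _ _ u0 x0))//.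
  by rewrite distrC ger0_norm// subr_ge0.
have leF2 u : x < u -> `|w u - w x| * upP a b u <= (u - x) * upP a b u.
  move=> xu; have u0 := lt_trans x0 xu.
  rewrite ler_wpM2r ?upP_ge0// (le_trans (lipw _ _ u0 x0))//.
  by rewrite ger0_norm// subr_ge0 ltW.
have [int0 le0] := expectation_K1_le 2 x0 wx cF1 cF2 leF1 leF2
  (integral_lowP_moment a0 b0 mass1 x0) (integral_upP_moment a0 b0 mass1 x0).
have c1 (u : R) : 0 < u -> {for u, continuous (cst (1 : R))}.
  by move=> _; exact: cvg_cst.
have n1 (u : R) : 0 < u -> `|cst 1 u : R| <= 1 by rewrite normr1.
(* The constant weight 1 gives the integrability of the bare kernel, required for linearity. *)
have [intK _] := expectation_K1_le1 2 x0 c1 n1.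
have {}intK : P.-integrable setT (fun z => (K1 a b 2 (X z) x)%:E).
  by apply: eq_integrable intK => // z _; rewrite mul1r.
have -> : ('E_P[fun z => (w (X z) * K1 a b 2 (X z) x)%R] =
    'E_P[fun z => ((w (X z) - w x) * K1 a b 2 (X z) x)%R] +
    (w x)%:E * 'E_P[fun z => K1 a b 2 (X z) x])%E.
  rewrite unlock -integralZl// -integralD//; last exact: integrableZl.
  by apply: eq_integral => z _; rewrite -EFinM -EFinD; congr EFin; ring.
(* The mean of the kernel is -1/(b x), so the constant part cancels [w x / (b * x)]. *)
rewrite expectation_K1_2// -addeA -EFinM -EFinD mulrN addNr adde0.
apply: le_trans le0 _.
rewrite alE beE /C2 alE beE Rintegral_lowP1// Rintegral_upP1//.
by rewrite !ger0_norm.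
Qed.

Lemma stein_sol_le (h : R -> R) (x : R) : classZ1 h -> 0 < x ->
  (`|stein_sol X a b h x| <= 1%:E)%E.
Proof.
move=> Zh x0; rewrite -(ratio_sum0 b0 mass1 x0).
have cw u : 0 < u -> {for u, continuous (derive1 h)} by move=> /Zh[].
have w1 u : 0 < u -> `|derive1 h u| <= 1 by move=> /Zh[].
have [_] := expectation_K1_le1 0 x0 cw w1; rewrite !derive1n0.
have qx0 : 0 <= b * x * p x by rewrite !mulr_ge0 ?gamma_pdf_ge0 ?ltW.
have uM0 : 0 <= upM a b x by apply: divr_ge0 => //; exact: upP_ge0.
have lM0 : 0 <= lowM a b x by apply: divr_ge0 => //; exact: lowP_ge0.
by rewrite (ger0_norm uM0) (ger0_norm lM0).
Qed.

(** The first derivative is nonpositive for [upM] and nonnegative for [lowM], so the sum of absolute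
    values is exactly [C1]. *)
Lemma stein_sol1_le (h : R -> R) (x : R) : classZ1 h -> 0 < x ->
  (`|stein_sol1 X a b h x| <= (C1 a b x)%:E)%E.
Proof.
move=> Zh x0.
have cw u : 0 < u -> {for u, continuous (derive1 h)} by move=> /Zh[].
have w1 u : 0 < u -> `|derive1 h u| <= 1 by move=> /Zh[].
have [_] := expectation_K1_le1 1 x0 cw w1; rewrite !derive1n1.
rewrite derive1_upM// derive1_lowM// C1E//.
have qx0 : 0 < b * x * (b * x * p x) by rewrite !mulr_gt0 ?p0.
have L1x : 0 <= L1 x by rewrite lowprim1_ge0// ltW.
have U1x : 0 <= U1 x by rewrite upprim1_ge0.
rewrite normrN !ger0_norm ?divr_ge0 ?(ltW qx0)//.
set D := b * x * (b * x * p x) in qx0 *.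
rewrite [X in (_ <= X%:E)%E -> _](_ : _ = 2 * L1 x * U1 x / D)//.
by field; rewrite gt_eqF.
Qed.

Lemma abse_le_EFin (e : \bar R) (r : R) : (`|e| <= r%:E)%E ->
  exists2 s : R, e = s%:E & `|s| <= r.
Proof. by case: e => [s||]//; rewrite abse_EFin lee_fin; exists s. Qed.

(** Kernel part and local term are each at most 1/(b x) in absolute value; the factor x turns their
    sum into 2/b. *)
Let xM_le (x c : R) (e : \bar R) : 0 < x -> (`|e| <= ((b * x)^-1)%:E)%E ->
  `|c| <= 1 -> (`|x%:E * (e + (c / (b * x))%:E)| <= (2 / b)%:E)%E.
Proof.
move=> x0 /abse_le_EFin[s -> sle] c1.
rewrite -EFinD -EFinM abse_EFin lee_fin normrM (gtr0_norm x0).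
have bx0 : 0 < (b * x)^-1 by rewrite invr_gt0 mulr_gt0.
have -> : 2 / b = x * ((b * x)^-1 + (b * x)^-1).
  by field; rewrite !gt_eqF.
rewrite ler_pM2l// (le_trans (ler_normD _ _))// lerD//.
by rewrite normrM (gtr0_norm bx0) ler_piMl// ltW.
Qed.

Lemma xstein_sol2_le (h : R -> R) (x : R) : classZ1 h -> 0 < x ->
  (`|x%:E * stein_sol2 X a b h x| <= (2 / b)%:E)%E.
Proof.
move=> Zh x0; apply: xM_le => //; last by have [] := Zh x x0.
have cw u : 0 < u -> {for u, continuous (derive1 h)} by move=> /Zh[].
have w1 u : 0 < u -> `|derive1 h u| <= 1 by move=> /Zh[].
have := ratio_sum2 b0 mass1 x0.
have := derive2_upM_ge0 x0; have := derive2_lowM_ge0 x0.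
have [_] := expectation_K1_le1 2 x0 cw w1.
(* Once generalized, the nonnegative second derivatives make the kernel bound the left side of
   [ratio_sum2]. *)
move: (derive1n 2 (upM a b) x) (derive1n 2 (lowM a b) x) => al be.
by move=> /[swap] be0 /[swap] al0 /[swap] <-; rewrite !ger0_norm.
Qed.

(** The weight is h', which is 1-Lipschitz on the positive half-line because |h''| <= 1. *)
Lemma stein_sol2_le (h : R -> R) (x : R) : classZ2 h -> 0 < x ->
  (`|stein_sol2 X a b h x| <= (C2 a b x)%:E)%E.
Proof.
move=> Zh x0; apply: expectation_K1_2_lipschitz => //.
  move=> u /Zh[_ dh _ _]; exact/differentiable_continuous/derivable1_diffP.
by apply: lipschitz_gt0 => u /Zh[_ dh _ +]; rewrite derive1nS derive1n1.
Qed.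

Lemma xstein_sol3_le (h : R -> R) (x : R) : classZ2 h -> 0 < x ->
  (`|x%:E * stein_sol3 X a b h x| <= (2 / b)%:E)%E.
Proof.
move=> Zh x0; apply: xM_le => //; last by have [] := Zh x x0.
have cw u : 0 < u -> {for u, continuous (derive1n 2 h)} by move=> /Zh[].
have w1 u : 0 < u -> `|derive1n 2 h u| <= 1 by move=> /Zh[].
have [al alE] : {al | derive1n 3 (upM a b) x = al} by eexists.
have [be beE] : {be | derive1n 3 (lowM a b) x = be} by eexists.
have bx3 : 0 <= (b * x) ^+ 3 * (b * x * p x).
  by rewrite !mulr_ge0 ?exprn_ge0 ?mulr_ge0 ?gamma_pdf_ge0// ltW.
have al0 : al <= 0.
  by rewrite -alE derive3_upM// oppr_le0 divr_ge0// mulr_ge0// upprim3_ge0.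
have be0 : 0 <= be.
  by rewrite -beE derive3_lowM// divr_ge0// mulr_ge0// lowprim3_ge0.
(* With [al <= 0 <= be], the absolute values reproduce the left side of [ratio_sum3]. *)
have := ratio_sum3 b0 mass1 x0; rewrite alE beE => <-.
have := expectation_K32_le x0 alE beE cw w1.
by rewrite (ler0_norm al0) (ger0_norm be0).
Qed.

End stein_bounds.

Theorem lemma1p6 (R : realType) (d : measure_display) (T : measurableType d)
    (P : probability T R) (X : {RV P >-> R}) (a b : R)
    (a_gt0 : 0 < a) (b_gt0 : 0 < b) (hX : gamma_distributed X a b)
    (h : R -> R) :
  (classZ1 h -> forall x : R, 0 < x -> let z := x / b in
    [/\ (`|stein_sol X a b h x| <= 1%:E)%E,
        (`|stein_sol1 X a b h x| <= (b^-1 * C1 a 1 z)%:E)%E,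
        (`|x%:E * stein_sol1 X a b h x| <= (z * C1 a 1 z)%:E)%E &
        (`|x%:E * stein_sol2 X a b h x| <= (2 / b)%:E)%E]) /\
  (classZ2 h -> forall x : R, 0 < x -> let z := x / b in
    (`|stein_sol2 X a b h x| <= (b^-1 * C2 a 1 z)%:E)%E /\
    (`|x%:E * stein_sol3 X a b h x| <= (2 / b)%:E)%E).
Proof.
have mass1 := gamma_distributed_mass hX.
split=> Zh x x0 z; last first.
  (* The estimates were obtained at scale [b]; scaling moves the constant to scale 1 at [z]. *)
  rewrite -C2_scale//; split; first exact: stein_sol2_le.
  exact: xstein_sol3_le.
have le1 := stein_sol1_le a_gt0 b_gt0 hX Zh x0.
split.
- exact: stein_sol_le.
- by rewrite -C1_scale.
(* This is the preceding bound multiplied by [x], as z = x / b. *)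
- have -> : z * C1 a 1 z = x * C1 a b x by rewrite (C1_scale a_gt0 b_gt0 mass1 x0) mulrA.
  by rewrite abseM abse_EFin (gtr0_norm x0) EFinM lee_pmul2l.
- exact: xstein_sol2_le.
Qed.
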